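(* Let $f\in\mathbb{R}^{d_1\times\cdots\times d_m}$, $f\ge0$, be weakly irreducible and $1<p_1,\ldots,p_m<\infty$ such that there is $i\in[m]$ with $(m-1)p_i'\le p_k$ for all $k\in[m]\setminus\{i\}$, where, if $m=2$, $i$ is chosen so that $p_i\le p_k$ for $k\in[2]\setminus\{i\}$. Let $\mathbf x^*\in\mathcal S^{d-d_i}$ be the unique strictly positive critical point of $Q_i$ in $\mathcal S^{d-d_i}_{++}$, and let $(\lambda_-^k)_{k\in\mathbb N}$, $(\lambda_+^k)_{k\in\mathbb N}\subset\mathbb{R}$ and $(\mathbf x^k)_{k\in\mathbb N}\subset\mathcal S^{d-d_i}$ be the sequences produced by HGPM with this index $i$. Then $(\mathbf x^k)$ converges to $\mathbf x^*$; $(\lambda_-^k)$, $(\lambda_+^k)$ and $(Q_i(\mathbf x^k))$ converge to $\|f\|_{p_1,\ldots,p_m}$; and there exist a norm $\|\cdot\|_G$ on $\mathcal R^{d-d_i}$, $0<\nu<1$ and $k_0\in\mathbb N$ such that $\|\mathbf x^{k+1}-\mathbf x^*\|_G\le\nu\|\mathbf x^k-\mathbf x^*\|_G$ for all $k\ge k_0$.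
   Context: $f$ is identified with the multilinear form $f(\mathbf x)=\sum f_{j_1,\ldots,j_m}x_{1,j_1}\cdots x_{m,j_m}$ on $\prod_k\mathbb{R}^{d_k}$; $\nabla_kf(\mathbf x)$ is the vector of partials $\partial f/\partial x_{k,j_k}$ (independent of $\mathbf x_k$, so $\nabla_if$ is defined on $\mathcal R^{d-d_i}=\prod_{k\ne i}\mathbb{R}^{d_k}$). $p'=p/(p-1)$; $\psi_q(\mathbf y)_j=|y_j|^{q-1}\mathrm{sign}(y_j)$. $\mathcal S^{d-d_i}$ (resp. $\mathcal S^{d-d_i}_{++}$) is the set of (entrywise positive) $\mathbf x\in\mathcal R^{d-d_i}$ with $\|\mathbf x_k\|_{p_k}=1$ for all $k\ne i$. $\|f\|_{p_1,\ldots,p_m}=\max|f(\mathbf x)|/\prod_k\|\mathbf x_k\|_{p_k}$; $Q_i(\mathbf x)=\|\nabla_if(\mathbf x)\|_{p_i'}/\prod_{k\ne i}\|\mathbf x_k\|_{p_k}$. For $k\ne i$, $s_{i,k}(\mathbf x)=\psi_{p_k'}\big(\nabla_kf(\mathbf x_1,\ldots,\mathbf x_{i-1},\psi_{p_i'}(\nabla_if(\mathbf x)),\mathbf x_{i+1},\ldots,\mathbf x_m)\big)$. HGPM with index $i$ and starting point $\mathbf x^0\in\mathcal S^{d-d_i}_{++}$: for $k=0,1,\dots$, $\mathbf z^k=(s_{i,l}(\mathbf x^k))_{l\ne i}$, $\lambda_-^{k+1}=\prod_{l\ne i}\min_{j_l}(z^k_{l,j_l}/x^k_{l,j_l})^{(p_l-1)/(p_i'(m-1))}$,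 $\lambda_+^{k+1}=\prod_{l\ne i}\max_{j_l}(z^k_{l,j_l}/x^k_{l,j_l})^{(p_l-1)/(p_i'(m-1))}$, $\mathbf x^{k+1}=(\mathbf z^k_l/\|\mathbf z^k_l\|_{p_l})_{l\ne i}$ (iterated indefinitely). Weak irreducibility: the undirected graph on $\bigcup_k\{k\}\times[d_k]$ with $(k,j_k)\sim(l,j_l)$ ($k\ne l$) iff $f_{j_1,\ldots,j_m}>0$ for some choice of the remaining indices, is connected. *)

(* Defs.v *)
From HB Require Import structures.
From mathcomp Require Import all_boot all_order all_algebra.
From mathcomp Require Import all_classical all_reals all_analysis.
Set Implicit Arguments. Unset Strict Implicit. Unset Printing Implicit Defensive.
Import Order.TTheory GRing.Theory Num.Theory.
Import numFieldNormedType.Exports.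
Local Open Scope ring_scope.
Local Open Scope classical_set_scope.

Section HGPM.
Variables (R : realType) (m : nat) (d : 'I_m -> nat).

Definition MI := {dffun forall k : 'I_m, 'I_(d k)}.

(* an element x = (x_1,...,x_m) of prod_k R^{d_k}; x k j is the j-th entry
   of x_k for j < d k (entries with j >= d k are irrelevant junk) *)
Definition mvec := 'I_m -> nat -> R.

Definition mvsub (x y : mvec) : mvec := fun k j => x k j - y k j.

Definition teval (f : MI -> R) (x : mvec) : R :=
  \sum_(J : MI) f J * \prod_(k < m) x k (J k).

Definition grad (f : MI -> R) (k : 'I_m) (x : mvec) : nat -> R :=
  fun j => \sum_(J : MI | val (J k) == j) f J * \prod_(l < m | l != k) x l (J l).

Definition pnorm (n : nat) (p : R) (v : nat -> R) : R :=
  (\sum_(j < n) `|v j| `^ p) `^ p^-1.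

Definition dual (p : R) : R := p / (p - 1).

Definition psi (q : R) (y : nat -> R) : nat -> R :=
  fun j => `|y j| `^ (q - 1) * Num.sg (y j).

Definition fnorm (f : MI -> R) (p : 'I_m -> R) : R :=
  sup [set r | exists x : mvec,
         (forall k, exists2 j, (j < d k)%N & x k j != 0) /\
         r = `|teval f x| / \prod_(k < m) pnorm (d k) (p k) (x k)].

Definition Qf (f : MI -> R) (p : 'I_m -> R) (i : 'I_m) (x : mvec) : R :=
  pnorm (d i) (dual (p i)) (grad f i x) /
    \prod_(k < m | k != i) pnorm (d k) (p k) (x k).

(* x in S^{d-d_i} and S^{d-d_i}_{++} (the i-th component is ignored) *)
Definition onS (p : 'I_m -> R) (i : 'I_m) (x : mvec) : Prop :=
  forall k, k != i -> pnorm (d k) (p k) (x k) = 1.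
Definition onSpp (p : 'I_m -> R) (i : 'I_m) (x : mvec) : Prop :=
  onS p i x /\ forall k, k != i -> forall j, (j < d k)%N -> 0 < x k j.

(* equality as elements of R^{d-d_i} *)
Definition eq_off (i : 'I_m) (x y : mvec) : Prop :=
  forall k, k != i -> forall j, (j < d k)%N -> x k j = y k j.

Definition replace (x : mvec) (i : 'I_m) (y : nat -> R) : mvec :=
  fun k => if k == i then y else x k.

Definition sHG (f : MI -> R) (p : 'I_m -> R) (i k : 'I_m) (x : mvec) : nat -> R :=
  psi (dual (p k)) (grad f k (replace x i (psi (dual (p i)) (grad f i x)))).

Definition bump (x : mvec) (l : 'I_m) (j : nat) (t : R) : mvec :=
  fun k j' => x k j' + (if (k == l) && (j' == j) then t else 0).

Definition critical (f : MI -> R) (p : 'I_m -> R) (i : 'I_m) (x : mvec) : Prop :=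
  forall l, l != i -> forall j, (j < d l)%N ->
    is_derive (0 : R) (1 : R) (fun t : R => Qf f p i (bump x l j t)) 0.

Definition wi_edge (f : MI -> R) : rel {k : 'I_m & 'I_(d k)} :=
  fun u v => (tag u != tag v) &&
    [exists J : MI, [&& J (tag u) == tagged u, J (tag v) == tagged v & 0 < f J]].
Definition weakly_irreducible (f : MI -> R) : Prop :=
  forall u v, connect (wi_edge f) u v.

(* N is a norm on R^{d-d_i} (as a function on mvec depending only on the
   coordinates x_{k,j}, k <> i, j < d_k) *)
Definition is_norm_off (i : 'I_m) (N : mvec -> R) : Prop :=
  [/\ forall x y, eq_off i x y -> N x = N y,
      forall x y, N (fun k j => x k j + y k j) <= N x + N y,
      forall (a : R) x, N (fun k j => a * x k j) = `|a| * N x &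
      forall x, N x = 0 -> eq_off i x (fun _ _ => 0)].

Definition HGPM_seq (f : MI -> R) (p : 'I_m -> R) (i : 'I_m)
    (x : nat -> mvec) (lm lp : nat -> R) : Prop :=
  forall n : nat,
  [/\ forall l, l != i -> forall j, (j < d l)%N ->
        x n.+1 l j = sHG f p i l (x n) j / pnorm (d l) (p l) (sHG f p i l (x n)),
      lm n.+1 = \prod_(l < m | l != i)
         (inf (range (fun j : 'I_(d l) => sHG f p i l (x n) j / x n l j)))
           `^ ((p l - 1) / (dual (p i) * (m.-1)%:R)) &
      lp n.+1 = \prod_(l < m | l != i)
         (sup (range (fun j : 'I_(d l) => sHG f p i l (x n) j / x n l j)))
           `^ ((p l - 1) / (dual (p i) * (m.-1)%:R))].

End HGPM.

(* Main.v *)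
(* In the coordinates x = xs e^v one step of HGPM before normalisation is a map
   v |-> tau v built from two log-sum-exp means, so tau fixes 0, is monotone and
   convex, and Jensen's inequality gives tau v >= D v for D its derivative at 0.
   The eigenvector equation at the critical point xs makes D self-adjoint for
   the weights W_{l,j} = (p_l - 1) F xs_{l,j}^{p_l}, where F is the p_i'-th power
   of the p_i'-norm of grad_i f(xs); D is nonnegative with row sums <= 1 because (m - 1) p_i' <= p_l, has positive diagonal because p_i' > 1,
   and is irreducible by weak irreducibility, so it contracts the W-norm on
   W-mean-zero vectors by some nu < 1.

   Globally, scale the start so that v <= 0.  Then sum W v is nondecreasing along
   the unnormalised orbit and bounded by 0, hence tau v - D v tends to 0, and the
   contraction drives the blockwise mean-free part of v, thus the normalised
   iterates, to 0.  Locally, tau v - D v, the block means of v and e^v - 1 - v are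
   all quadratic in v, which gives the linear rate in the norm
   (sum W (h / xs)^2)^(1/2).

   The common limit F^(1/p_i') is the tensor norm: f_J prod_k xs_k(J_k) is, up to
   scaling, a probability on multi-indices with marginals xs_k^{p_k}, and the
   upper bound is Young's inequality since sum_k 1/p_k <= 1. *)
Require Import Defs.
From HB Require Import structures.
From mathcomp Require Import all_boot all_order all_algebra.
From mathcomp Require Import all_classical all_reals all_analysis.
From mathcomp Require Import ring lra.
Set Implicit Arguments.
Unset Strict Implicit.
Unset Printing Implicit Defensive.
Import Order.TTheory GRing.Theory Num.Theory.
Import numFieldNormedType.Exports.
Local Open Scope ring_scope.
Local Open Scope classical_set_scope.

(** * A quadratic upper bound for the exponential *)

Section ExpBounds.
Variable R : realType.
Implicit Types x : R.

(** From [1 - x <= expR (- x)] one gets [expR x <= (1 - x)^-1], and [(1 + x + 2 x^2) (1 - x) = 1 +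
    x^2 (1 - 2 x) >= 1]. *)
Lemma expR_le_quad x : x <= 2^-1 -> expR x <= 1 + x + 2 * x ^+ 2.
Proof.
move=> xh; have h1 : 0 < 1 - x by lra.
have : expR x <= (1 - x)^-1.
  rewrite -[expR x]invrK lef_pV2 ?posrE ?invr_gt0 ?expR_gt0//.
  by rewrite -expRN; exact: (expR_ge1Dx (- x)).
move/le_trans; apply; rewrite -[leLHS]mul1r ler_pdivrMr//.
have : 0 <= x ^+ 2 * (1 - 2 * x) by rewrite mulr_ge0 ?sqr_ge0//; lra.
by rewrite expr2 => h; lra.
Qed.

End ExpBounds.

(** * Weighted Euclidean norms and the spectral gap *)

Section WeightedNorm.
Variables (R : realType) (I : finType) (W : I -> R).
Hypothesis W0 : forall a, 0 <= W a.
Implicit Types u v : I -> R.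

(** Only a seminorm, since weights may vanish; hence the pointwise hypotheses below are restricted
    to [W a != 0]. *)
Definition wnorm v : R := Num.sqrt (\sum_a W a * v a ^+ 2).

Lemma sqr_sum_ge0 v : 0 <= \sum_a W a * v a ^+ 2.
Proof. by apply: sumr_ge0 => a _; rewrite mulr_ge0// sqr_ge0. Qed.

Lemma wnorm_ge0 v : 0 <= wnorm v.
Proof. exact: sqrtr_ge0. Qed.

Lemma sqr_wnorm v : wnorm v ^+ 2 = \sum_a W a * v a ^+ 2.
Proof. by rewrite sqr_sqrtr// sqr_sum_ge0. Qed.

Lemma wnorm_le v c : 0 <= c -> \sum_a W a * v a ^+ 2 <= c ^+ 2 -> wnorm v <= c.
Proof.
by move=> c0 h; rewrite -(@ler_pXn2r _ 2)// ?nnegrE ?wnorm_ge0// sqr_wnorm.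
Qed.

Lemma le_wnorm u v : (forall a, W a != 0 -> `|u a| <= `|v a|) ->
  wnorm u <= wnorm v.
Proof.
move=> uv; apply: ler_wsqrtr; apply: ler_sum => a _.
have [->|Wa] := eqVneq (W a) 0; first by rewrite !mul0r.
by rewrite ler_wpM2l// -[u a ^+ 2]real_normK ?num_real//
  -[v a ^+ 2]real_normK ?num_real// ler_pXn2r// ?nnegrE// uv.
Qed.

Lemma eq_wnorm u v : (forall a, W a != 0 -> u a = v a) -> wnorm u = wnorm v.
Proof. by move=> uv; apply/eqP; rewrite eq_le !le_wnorm// => a /uv ->. Qed.

Lemma wnormZ c v : wnorm (fun a => c * v a) = `|c| * wnorm v.
Proof.
rewrite /wnorm -sqrtr_sqr -sqrtrM ?sqr_ge0//; congr Num.sqrt.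
by rewrite mulr_sumr; apply: eq_bigr => a _; rewrite exprMn mulrCA.
Qed.

Lemma cauchy_schwarz_wnorm u v :
  \sum_a W a * (u a * v a) <= wnorm u * wnorm v.
Proof.
set A := wnorm u; set B := wnorm v.
have A0 : 0 <= A := wnorm_ge0 u. have B0 : 0 <= B := wnorm_ge0 v.
have zero w z : wnorm w = 0 -> \sum_a W a * (w a * z a) = 0.
  move=> w0; have := sqr_wnorm w; rewrite w0 expr0n/= => /esym/eqP.
  rewrite psumr_eq0 => [/allP h|a _]; last by rewrite mulr_ge0// sqr_ge0.
  rewrite big1// => a _; have := h a (mem_index_enum _).
  by rewrite mulf_eq0 sqrf_eq0 => /orP[]/eqP ->; rewrite ?mul0r ?mulr0.
have [A00|A00] := eqVneq A 0; first by rewrite zero// A00 mul0r.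
have [B00|B00] := eqVneq B 0.
  under eq_bigr do rewrite [u _ * _]mulrC.
  by rewrite zero// B00 mulr0.
have AB : 0 < A * B by rewrite mulr_gt0// lt_def ?A00 ?B00.
(* The weighted square of [B u - A v] equals [2 A B] times the difference to be bounded. *)
have := sqr_sum_ge0 (fun a => B * u a - A * v a).
have -> : \sum_a W a * (B * u a - A * v a) ^+ 2 =
    B ^+ 2 * (\sum_a W a * u a ^+ 2) + A ^+ 2 * (\sum_a W a * v a ^+ 2)
    - 2 * (A * B) * \sum_a W a * (u a * v a).
  rewrite !mulr_sumr -big_split -sumrB/=.
  by apply: eq_bigr => a _; ring.
rewrite -!sqr_wnorm -/A -/B => h; rewrite -(ler_pM2l AB); nra.
Qed.

Lemma ler_wnormD u v : wnorm (fun a => u a + v a) <= wnorm u + wnorm v.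
Proof.
apply: wnorm_le; first by rewrite addr_ge0 ?wnorm_ge0.
have -> : \sum_a W a * (u a + v a) ^+ 2 =
   wnorm u ^+ 2 + wnorm v ^+ 2 + 2 * \sum_a W a * (u a * v a).
  rewrite !sqr_wnorm mulr_sumr -!big_split/=; apply: eq_bigr => a _; ring.
have := cauchy_schwarz_wnorm u v; nra.
Qed.

Lemma wnorm_const_le v c : 0 <= c -> (forall a, W a != 0 -> `|v a| <= c) ->
  wnorm v <= c * Num.sqrt (\sum_a W a).
Proof.
move=> c0 vc; have -> : c * Num.sqrt (\sum_a W a) = wnorm (fun=> c).
  by rewrite /wnorm -mulr_suml sqrtrM ?sumr_ge0// sqrtr_sqr ger0_norm// mulrC.
by apply: le_wnorm => a /vc; rewrite (ger0_norm c0).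
Qed.

(** Zero weights add nothing to the constant because [0^-1 = 0]. *)
Lemma coord_le_wnorm v a : W a != 0 ->
  `|v a| <= Num.sqrt (\sum_b (W b)^-1) * wnorm v.
Proof.
move=> Wa; rewrite -sqrtr_sqr -sqrtrM; last first.
  by apply: sumr_ge0 => b _; rewrite invr_ge0.
apply: ler_wsqrtr.
have -> : v a ^+ 2 = (W a)^-1 * (W a * v a ^+ 2) by rewrite mulKf.
apply: ler_pM.
- by rewrite invr_ge0.
- by rewrite mulr_ge0// sqr_ge0.
- by rewrite (bigD1 a)//= lerDl sumr_ge0// => b _; rewrite invr_ge0.
- by rewrite (bigD1 a)//= lerDl sumr_ge0// => b _; rewrite mulr_ge0// sqr_ge0.
Qed.

End WeightedNorm.

(** * Spectral gap of a symmetric kernel with row sums at most [W] *)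

Section Gap.
Variables (R : realType) (I : finType) (W : I -> R) (K : I -> I -> R).
Hypothesis K0 : forall a b, 0 <= K a b.
Hypothesis KC : forall a b, K a b = K b a.
Hypothesis KW : forall a, \sum_b K a b <= W a.

(** Self-adjoint for the weights [W] because [K] is symmetric. Where [W a = 0] the division gives 0,
    consistent with the vanishing of row [a] of [K]. *)
Definition kop (v : I -> R) (a : I) : R := (\sum_b K a b * v b) / W a.

Lemma W_ge0 a : 0 <= W a.
Proof. by apply: le_trans (KW a); exact: sumr_ge0. Qed.

Lemma K_le_W a b : K a b <= W a.
Proof. by apply: le_trans (KW a); rewrite (bigD1 b)//= lerDl sumr_ge0. Qed.

Lemma mulW_kop v a : W a * kop v a = \sum_b K a b * v b.
Proof.
rewrite /kop mulrC; have [Wa|Wa] := eqVneq (W a) 0; last by rewrite divfK.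
rewrite Wa mulr0 big1// => b _; suff -> : K a b = 0 by rewrite mul0r.
by apply: le_anti; rewrite K0 andbT -Wa K_le_W.
Qed.

Lemma kopD u v a : kop (fun b => u b + v b) a = kop u a + kop v a.
Proof.
rewrite /kop -mulrDl -big_split/=; congr (_ / _); apply: eq_bigr => b _.
by rewrite mulrDr.
Qed.

(** Column sums of [K] are at most [W] by symmetry; multiplying by [v <= 0] reverses the
    inequality. *)
Lemma kop_sum_le0 v : (forall a, v a <= 0) ->
  \sum_a W a * v a <= \sum_a W a * kop v a.
Proof.
move=> v0; under [leRHS]eq_bigr do rewrite mulW_kop.
rewrite exchange_big; apply: ler_sum => b _/=; rewrite -mulr_suml.
by apply: ler_wnM2r => //; under eq_bigr do rewrite KC; exact: KW.
Qed.

(** Spread of [v] around its averages [kop v a]; a lower bound for the squared norm lost under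
    [kop]. *)
Definition dissipation (v : I -> R) := \sum_a \sum_b K a b * (v b - kop v a) ^+ 2.

Lemma dissipation_ge0 v : 0 <= dissipation v.
Proof. by do 2![apply: sumr_ge0 => ? _]; rewrite mulr_ge0// sqr_ge0. Qed.

(** Expanding the square in row [a] gives [W a * kop v a ^+ 2] twice with a minus sign and, by [KW],
    at most once with a plus sign. The sum over rows then uses the column sums. *)
Lemma wnorm_kop_dissipation v :
  wnorm W (kop v) ^+ 2 <= wnorm W v ^+ 2 - dissipation v.
Proof.
rewrite !sqr_wnorm; try exact: W_ge0.
have h a : W a * kop v a ^+ 2 <= \sum_b K a b * v b ^+ 2
     - \sum_b K a b * (v b - kop v a) ^+ 2.
  have -> : \sum_b K a b * (v b - kop v a) ^+ 2 = \sum_b K a b * v b ^+ 2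
     - 2 * kop v a * (\sum_b K a b * v b) + kop v a ^+ 2 * \sum_b K a b.
    rewrite !mulr_sumr -sumrB -big_split/=; apply: eq_bigr => b _; ring.
  rewrite -(mulW_kop v a).
  have := KW a; rewrite -subr_ge0 => /(mulr_ge0 (sqr_ge0 (kop v a))).
  by move=> ?; lra.
apply: le_trans (ler_sum _ (fun a _ => h a)) _.
rewrite sumrB lerD2r exchange_big; apply: ler_sum => b _ /=.
rewrite -mulr_suml ler_wpM2r ?sqr_ge0//.
by under eq_bigr do rewrite KC; exact: KW.
Qed.

Hypothesis Kdiag : forall a, W a != 0 -> 0 < K a a.
Hypothesis Kconn : forall a b, W a != 0 -> W b != 0 ->
  connect (fun a b => 0 < K a b) a b.

Lemma dissipation_edge v a b :
  K a b * (v b - kop v a) ^+ 2 <= dissipation v.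
Proof.
rewrite /dissipation (bigD1 a)//= (bigD1 b)//= -addrA lerDl addr_ge0//.
  by apply: sumr_ge0 => c _; rewrite mulr_ge0// sqr_ge0.
by do 2![apply: sumr_ge0 => ? _]; rewrite mulr_ge0// sqr_ge0.
Qed.

Lemma sqrD_le (x y z A B : R) : (x - y) ^+ 2 <= A -> (y - z) ^+ 2 <= B ->
  (x - z) ^+ 2 <= 2 * (A + B).
Proof. have := sqr_ge0 ((x - y) - (y - z)); nra. Qed.

(** Induction along a path. On an edge both ends are compared with [kop v a]: the loop [K a a]
    controls [v a] and the entry [K a c] controls [v c]. *)
Lemma dissipation_diff a b : W a != 0 -> W b != 0 ->
  exists2 C, 0 <= C & forall v, (v a - v b) ^+ 2 <= C * dissipation v.
Proof.
move=> Wa Wb; have /connectP[s] := Kconn Wa Wb.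
elim: s a Wa => [|c s IH] a Wa /=.
  by move=> _ ->; exists 0 => // v; rewrite subrr expr0n mul0r.
move=> /andP[Kac pth] lst.
have Wc : W c != 0 by rewrite gt_eqF// (lt_le_trans Kac)// KC K_le_W.
have [C C0 HC] := IH c Wc pth lst.
pose E := 2 * ((K a a)^-1 + (K a c)^-1).
have E0 : 0 <= E by rewrite mulr_ge0// addr_ge0// invr_ge0.
exists (2 * (E + C)); first by rewrite mulr_ge0// addr_ge0.
move=> v; rewrite [leRHS](_ : _ = 2 * (E * dissipation v + C * dissipation v));
  last by ring.
apply: (@sqrD_le _ (v c)) => //.
rewrite [leRHS](_ : _ = 2 * ((K a a)^-1 * dissipation v + (K a c)^-1 * dissipation v));
  last by rewrite /E; ring.
apply: (@sqrD_le _ (kop v a)).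
  by rewrite mulrC ler_pdivlMr ?Kdiag// mulrC dissipation_edge.
by rewrite -sqrrN opprB mulrC ler_pdivlMr// mulrC dissipation_edge.
Qed.

Lemma dissipation_diff_uniform : exists2 C, 0 <= C & forall v a b,
  W a != 0 -> W b != 0 -> (v a - v b) ^+ 2 <= C * dissipation v.
Proof.
have /choice[C HC] : forall ab : I * I, exists C, 0 <= C /\ forall v,
    W ab.1 != 0 -> W ab.2 != 0 -> (v ab.1 - v ab.2) ^+ 2 <= C * dissipation v.
  move=> [a b]/=; have [Wa|Wa] := eqVneq (W a) 0; first by exists 0.
  have [Wb|Wb] := eqVneq (W b) 0; first by exists 0.
  by have [C C0 H] := dissipation_diff Wa Wb; exists C.
have C0 ab : 0 <= C ab by have [] := HC ab.
exists (\sum_ab C ab); first exact: sumr_ge0.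
move=> v a b Wa Wb; have [_ /(_ v Wa Wb)/le_trans] := HC (a, b); apply.
apply: ler_wpM2r; first exact: dissipation_ge0.
by rewrite (bigD1 (a, b))//= lerDl sumr_ge0.
Qed.

(** Poincare inequality: for mean-zero [v] the squared norm is at most [C'] times the dissipation,
    so [kop] multiplies it by at most [1 - C'^-1]. *)
Lemma kop_gap : exists2 nu, 0 <= nu < 1 & forall v, \sum_a W a * v a = 0 ->
  wnorm W (kop v) <= nu * wnorm W v.
Proof.
have [C C0 HC] := dissipation_diff_uniform.
(* The summand 1 ensures [C' >= 1], hence [0 <= 1 - C'^-1 < 1], even if [M] or [C] vanishes. *)
pose M := \sum_a W a; pose C' := 1 + M * C.
have M0 : 0 <= M by apply: sumr_ge0 => a _; exact: W_ge0.
have C'1 : 1 <= C' by rewrite lerDl mulr_ge0.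
have C'0 : 0 < C' := lt_le_trans ltr01 C'1.
have poin v : \sum_a W a * v a = 0 -> wnorm W v ^+ 2 <= C' * dissipation v.
  move=> v0; have D0 := dissipation_ge0 v.
  have [M00|M00] := eqVneq M 0.
    rewrite sqr_wnorm; last exact: W_ge0.
    rewrite big1 ?mulr_ge0// ?(ltW C'0)// => a _.
    suff -> : W a = 0 by rewrite mul0r.
    apply: le_anti; rewrite W_ge0 andbT -M00 /M (bigD1 a)//= lerDl sumr_ge0//.
    by move=> b _; exact: W_ge0.
  have Mp : 0 < M by rewrite lt_def M00.
  have : \sum_a \sum_b W a * (W b * (v a - v b) ^+ 2) <=
         \sum_a \sum_b W a * (W b * (C * dissipation v)).
    apply: ler_sum => a _; apply: ler_sum => b _.
    have [->|Wa] := eqVneq (W a) 0; first by rewrite !mul0r.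
    have [->|Wb] := eqVneq (W b) 0; first by rewrite !mul0r !mulr0.
    by rewrite !ler_wpM2l ?W_ge0// HC.
  have -> : \sum_a \sum_b W a * (W b * (C * dissipation v)) =
      M ^+ 2 * (C * dissipation v).
    under eq_bigr do rewrite -mulr_sumr -mulr_suml.
    by rewrite -mulr_suml -/M mulrA expr2.
  (* Variance identity: the cross terms carry the factor [\sum_b W b * v b], which is zero. *)
  have -> : \sum_a \sum_b W a * (W b * (v a - v b) ^+ 2) =
      2 * M * wnorm W v ^+ 2.
    rewrite sqr_wnorm; last exact: W_ge0.
    pose S := \sum_a W a * v a ^+ 2.
    have h a : \sum_b W a * (W b * (v a - v b) ^+ 2) =
        M * (W a * v a ^+ 2) + W a * S.
      rewrite [RHS](_ : _ = M * (W a * v a ^+ 2) + W a * S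
        - 2 * W a * v a * \sum_b W b * v b); last by rewrite v0; ring.
      rewrite /S /M mulr_suml !mulr_sumr -big_split -sumrB/=.
      by apply: eq_bigr => b _; ring.
    under eq_bigr do rewrite h.
    rewrite big_split/= -mulr_sumr -mulr_suml -/M -/S; ring.
  rewrite (_ : 2 * M * _ = M * (2 * wnorm W v ^+ 2)); last by ring.
  rewrite (_ : M ^+ 2 * _ = M * (M * C * dissipation v)); last by ring.
  rewrite ler_pM2l//; have := sqr_ge0 (wnorm W v).
  by rewrite /C' mulrDl mul1r; nra.
pose nu2 := 1 - C'^-1.
have nu20 : 0 <= nu2 < 1.
  by rewrite subr_ge0 ltrBlDr ltrDl invr_gt0 C'0 invf_le1// C'1.
case/andP: nu20 => nu20 nu21.
exists (Num.sqrt nu2); first by rewrite sqrtr_ge0/= -sqrtr1 ltr_sqrt.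
move=> v v0; rewrite -(@ler_pXn2r _ 2)// ?nnegrE ?mulr_ge0 ?sqrtr_ge0//.
rewrite exprMn (sqr_sqrtr nu20); apply: le_trans (wnorm_kop_dissipation v) _.
rewrite /nu2 mulrBl mul1r lerD2l lerN2 mulrC ler_pdivrMr// mulrC.
exact: poin.
Qed.

End Gap.

(** * Orbits of convex perturbations of a kernel *)

Section Sequences.
Variable R : realType.
Implicit Types r e a b : nat -> R.

Lemma cvg0_eventually_le r c : r @ \oo --> (0 : R) -> 0 < c ->
  exists N, forall n, (N <= n)%N -> r n <= c.
Proof.
move=> /cvgrPdist_le/(_ _ _)/[apply] [[N _ H]]; exists N => n Nn.
have := H n Nn; rewrite sub0r normrN; exact/le_trans/ler_norm.
Qed.


(** Once the errors are below [(1 - nu) * (eps / 2)], the bounding recursion has the fixed point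
    [eps / 2], and the excess decays geometrically. *)
Lemma contraction_cvg0 r e nu : 0 <= nu < 1 -> (forall n, 0 <= r n) ->
  (forall n, r n.+1 <= nu * r n + e n) -> e @ \oo --> (0 : R) ->
  r @ \oo --> (0 : R).
Proof.
move=> /andP[nu0 nu1] r0 Hr He; apply/cvgrPdist_le => eps eps0.
have e20 : 0 < eps / 2 by rewrite divr_gt0.
have c0 : 0 < (1 - nu) * (eps / 2) by rewrite mulr_gt0 ?subr_gt0.
have [N HN] := cvg0_eventually_le He c0.
have geo k : r (N + k)%N <= nu ^+ k * r N + eps / 2.
  elim: k => [|k IH]; first by rewrite addn0 expr0 mul1r lerDl ltW.
  rewrite addnS (le_trans (Hr _))// exprS -mulrA.
  have := ler_wpM2l nu0 IH; have := HN (N + k)%N (leq_addr _ _).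
  by move=> ? ?; lra.
have : (fun k => nu ^+ k * r N) @ \oo --> (0 : R).
  rewrite -[X in _ --> X](mul0r (r N)); apply: cvgM; last exact: cvg_cst.
  by apply: cvg_expr; rewrite ger0_norm.
move=> /cvg0_eventually_le/(_ e20) [k0 Hk0].
exists (N + k0)%N => // n /= Nn; rewrite sub0r normrN ger0_norm//.
have Nn' : (N <= n)%N by apply: leq_trans Nn; rewrite leq_addr.
have := geo (n - N)%N; rewrite subnKC// => /le_trans; apply.
have := Hk0 (n - N)%N; rewrite leq_subRL// => /(_ Nn) ?; lra.
Qed.

Lemma increments_cvg0 r : (forall n, r n <= r n.+1) -> (forall n, r n <= 0) ->
  (fun n => r n.+1 - r n) @ \oo --> (0 : R).
Proof.
move=> r1 r0; have cr : cvgn r.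
  apply: nondecreasing_is_cvgn; first exact/nondecreasing_seqP.
  by exists 0 => _ [n _ <-].
rewrite -[X in _ --> X](subrr (limn r)); apply: cvgB => //.
by rewrite cvg_shiftS.
Qed.

(** [b] contracts up to quadratic errors and [a] agrees with [b] to second order; the rate obtained
    is the midpoint of [nu] and 1. *)
Lemma quadratic_perturbation_rate a b nu L N0 : 0 <= nu < 1 -> 0 <= L ->
  (forall n, 0 <= b n) -> b @ \oo --> (0 : R) ->
  (forall n, (N0 <= n)%N -> b n.+1 <= nu * b n + L * b n ^+ 2 + L * b n.+1 ^+ 2) ->
  (forall n, (N0 <= n)%N -> `|a n - b n| <= L * b n ^+ 2) ->
  exists nu', 0 < nu' < 1 /\ exists N, forall n, (N <= n)%N ->
    a n.+1 <= nu' * a n.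
Proof.
move=> /andP[nu0 nu1] L0 b0 bcv Hb Hab.
(* Quadratic errors will be at most [eta] times [b]. They cost a few multiples of [eta], whereas the
   gap [1 - nu] is [20 * eta]. *)
pose eta := (1 - nu) / 20.
have eta0 : 0 < eta by rewrite /eta; lra.
have eta1 : eta <= 1 / 20 by rewrite /eta; lra.
have nuE : nu = 1 - 20 * eta by rewrite /eta; lra.
have c0 : 0 < eta / (L + 1) by rewrite divr_gt0// ltr_wpDl.
have [N1 HN1] := cvg0_eventually_le bcv c0.
have small n : (N1 <= n)%N -> L * b n ^+ 2 <= eta * b n.
  move=> /HN1; rewrite ler_pdivlMr ?ltr_wpDl// expr2 => h.
  have := b0 n; nra.
exists (1 - 10 * eta); split; first by apply/andP; split; lra.
exists (maxn N0 N1) => n; rewrite geq_max => /andP[n0 n1].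
have := small _ n1; have := small _ (leqW n1).
have := Hb _ n0; have := Hab _ n0; have := Hab _ (leqW n0).
have := b0 n; have := b0 n.+1.
rewrite !ler_norml; set x := b n; set y := b n.+1; set u := a n; set w := a n.+1.
move=> y0 x0 /andP[_ h1] /andP[h2 _] h3 h4 h5.
have y1 : y * (1 - eta) <= (1 - 19 * eta) * x by rewrite nuE in h3; lra.
have w1 : w <= (1 + eta) * y by lra.
have u1 : (1 - eta) * x <= u by lra.
have w2 : w * (1 - eta) <= (1 + eta) * ((1 - 19 * eta) * x).
  apply: (@le_trans _ _ ((1 + eta) * y * (1 - eta))).
    by rewrite ler_wpM2r//; lra.
  by rewrite -mulrA ler_wpM2l//; lra.
have e1 : 0 < 1 - eta by lra.
rewrite -(ler_pM2r e1); apply: (le_trans w2).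
apply: (@le_trans _ _ ((1 - 10 * eta) * ((1 - eta) * x) * (1 - eta))); last first.
  by rewrite ler_wpM2r ?(ltW e1)// ler_wpM2l//; lra.
rewrite -subr_ge0 (_ : _ - _ = x * (eta * (6 + 40 * eta - 10 * eta ^+ 2)));
  last by ring.
by rewrite mulr_ge0// mulr_ge0 ?ltW//; nra.
Qed.

End Sequences.

(** * Convergence and linear rate of an orbit considered modulo block constants *)

Section Dynamics.
Variables (R : realType) (I B : finType) (bl : I -> B).
Variables (W : I -> R) (K : I -> I -> R).
Hypothesis K0 : forall a b, 0 <= K a b.
Hypothesis KC : forall a b, K a b = K b a.
Hypothesis KW : forall a, \sum_b K a b <= W a.
Hypothesis Kdiag : forall a, W a != 0 -> 0 < K a a.
Hypothesis Kconn : forall a b, W a != 0 -> W b != 0 ->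
  connect (fun a b => 0 < K a b) a b.

Local Notation Kop := (kop W K).
Let W0 := W_ge0 K0 KW.

Definition bconst (u : I -> R) := forall a b, bl a = bl b -> u a = u b.

Definition bmean (v : I -> R) (k : B) :=
  (\sum_(b | bl b == k) W b * v b) / \sum_(b | bl b == k) W b.

(** The [W]-orthogonal projection away from block constants. In logarithmic coordinates a block
    constant rescales a block, so [bproj] does not see the normalisation of the iterates. *)
Definition bproj (v : I -> R) (a : I) := v a - bmean v (bl a).

Lemma bsum_gt0 a : W a != 0 -> 0 < \sum_(b | bl b == bl a) W b.
Proof.
move=> Wa; rewrite (bigD1 a)//= ltr_pwDl// ?lt_def ?Wa ?W0//.
by apply: sumr_ge0 => b _; exact: W0.
Qed.

Lemma bmean_bconst u a : bconst u -> W a != 0 -> bmean u (bl a) = u a.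
Proof.
move=> cu Wa; rewrite /bmean (eq_bigr (fun b => W b * u a)).
  by rewrite -mulr_suml mulrAC divff ?mul1r// gt_eqF// bsum_gt0.
by move=> b /eqP /cu ->.
Qed.

Lemma bmeanD u v k : bmean (fun a => u a + v a) k = bmean u k + bmean v k.
Proof.
rewrite /bmean -mulrDl -big_split/=; congr (_ / _).
by apply: eq_bigr => b _; rewrite mulrDr.
Qed.

(** On every block the deviations from the mean have [W]-sum zero; a block of total weight 0 has all
    its weights 0. *)
Lemma sum_bproj (c : B -> R) v : \sum_a c (bl a) * (W a * bproj v a) = 0.
Proof.
rewrite (partition_big bl xpredT)//= big1// => k _.
rewrite (eq_bigr (fun a => c k * (W a * v a - W a * bmean v k))); last first.
  by move=> a /eqP <-; rewrite -mulrBr.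
rewrite -mulr_sumr sumrB -mulr_suml /bmean mulrCA.
have [S0|S0] := eqVneq (\sum_(a | bl a == k) W a) 0; last first.
  by rewrite divff// mulr1 subrr mulr0.
rewrite S0 mul0r mulr0 subr0 big1 ?mulr0// => a ka.
move/eqP: S0; rewrite psumr_eq0 => [/allP/(_ a (mem_index_enum _))|b _//].
by rewrite ka/= => /eqP ->; rewrite mul0r.
Qed.

Lemma sumW_bproj v : \sum_a W a * bproj v a = 0.
Proof.
by rewrite -[RHS](sum_bproj (fun=> 1) v); apply: eq_bigr => a _; rewrite mul1r.
Qed.

(** Pythagoras: by [sum_bproj] the block means are orthogonal to the deviations. *)
Lemma wnorm_bproj v : wnorm W (bproj v) <= wnorm W v.
Proof.
apply: ler_wsqrtr; rewrite -subr_ge0.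
have -> : \sum_a W a * v a ^+ 2 - \sum_a W a * bproj v a ^+ 2 =
    \sum_a W a * bmean v (bl a) ^+ 2
    + 2 * \sum_a bmean v (bl a) * (W a * bproj v a).
  rewrite mulr_sumr -sumrB -big_split/=; apply: eq_bigr => a _.
  by rewrite /bproj; ring.
rewrite sum_bproj mulr0 addr0; exact: sqr_sum_ge0.
Qed.

Lemma eq_wnorm_bproj u v : bconst (fun a => u a - v a) ->
  wnorm W (bproj u) = wnorm W (bproj v).
Proof.
move=> cuv; apply: eq_wnorm => // a Wa.
rewrite -[u in LHS](_ : (fun a => (u a - v a) + v a) = u); last first.
  by apply/funext => b; rewrite subrK.
by rewrite /bproj bmeanD (bmean_bconst cuv)//; ring.
Qed.

Variable tau : (I -> R) -> I -> R.
Hypothesis kop_bconst : forall c : B -> R, bconst (Kop (fun a => c (bl a))).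
Hypothesis tau_bconst : forall u v, bconst (fun a => u a - v a) ->
  bconst (fun a => tau u a - tau v a).
Hypothesis tau_ge : forall v a, Kop v a <= tau v a.
Hypothesis tau_le0 : forall v, (forall a, v a <= 0) -> forall a, tau v a <= 0.

(** Modulo block constants, [tau v] is [Kop (bproj v)] plus the defect [tau v - Kop v]; the gap
    applies because [bproj v] has [W]-mean zero. *)
Lemma wnorm_bproj_tau nu v :
  (forall v, \sum_a W a * v a = 0 -> wnorm W (Kop v) <= nu * wnorm W v) ->
  wnorm W (bproj (tau v)) <=
    nu * wnorm W (bproj v) + wnorm W (fun a => tau v a - Kop v a).
Proof.
move=> gap; pose u a := Kop (bproj v) a + (tau v a - Kop v a).
rewrite (@eq_wnorm_bproj _ u); last first.
  have -> : (fun a => tau v a - u a) = Kop (fun a => bmean v (bl a)).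
    apply/funext => a; rewrite /u.
    have -> : Kop v a = Kop (bproj v) a + Kop (fun a => bmean v (bl a)) a.
      by rewrite -kopD; congr (kop _ _ _ _); apply/funext => b; rewrite subrK.
    by ring.
  exact: kop_bconst.
apply: le_trans (wnorm_bproj _) _; apply: le_trans (ler_wnormD W0 _ _) _.
by rewrite lerD2r; apply: gap; exact: sumW_bproj.
Qed.

Variables (pw : B -> R) (v : nat -> I -> R).
Hypothesis pw0 : forall k, 0 < pw k.
Hypothesis v_supp : forall n a, W a = 0 -> v n a = 0.
Hypothesis v_step : forall n, bconst (fun a => v n.+1 a - tau (v n) a).
Hypothesis v_norm : forall n k,
  \sum_(a | bl a == k) W a * (expR (pw k * v n a) - 1) = 0.

(* Shifting the orbit by a constant below [0] makes the total weight of the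
   unnormalised orbit nondecreasing, which forces [tau - Kop] to vanish. *)
Lemma wnorm_bproj_cvg0 : (fun n => wnorm W (bproj (v n))) @ \oo --> (0 : R).
Proof.
have [nu nu01 gap] := kop_gap K0 KC KW Kdiag Kconn.
pose V n := iter n tau (fun a => v 0%N a - \sum_b `|v 0%N b|).
have V0 n a : V n a <= 0.
  elim: n a => [|n IH] a /=; last exact: tau_le0.
  rewrite subr_le0 (bigD1 a)//= (le_trans (ler_norm _))// lerDl.
  exact: sumr_ge0.
have Vv n : bconst (fun a => V n a - v n a).
  elim: n => [|n IH] a b ab /=; first by ring.
  have := tau_bconst IH ab; have := v_step n ab => /=; lra.
pose E n := \sum_a W a * V n a.
pose e n a := tau (V n) a - Kop (V n) a.
have e0 n a : 0 <= e n a by rewrite subr_ge0.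
(* Since [V n <= 0], applying [Kop] does not decrease the weighted sum, so the increment of [E]
   dominates the whole defect. *)
have We n : \sum_a W a * e n a <= E n.+1 - E n.
  have := kop_sum_le0 K0 KC KW (V0 n); rewrite /E /e /=.
  under [X in _ -> X <= _]eq_bigr do rewrite mulrBr.
  by rewrite sumrB; lra.
have E1 n : E n <= E n.+1.
  rewrite -subr_ge0; apply: le_trans (We n); apply: sumr_ge0 => a _.
  by rewrite mulr_ge0.
have E0 n : E n <= 0.
  rewrite -oppr_ge0 -sumrN; apply: sumr_ge0 => a _.
  by rewrite -mulrN mulr_ge0// oppr_ge0.
have Ecv := increments_cvg0 E1 E0.
pose S := Num.sqrt (\sum_a (W a)^-1).
(* From a weighted sum to a weighted square norm: [W e^2 = (W e)^2 / W], and each [W a * e n a] is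
   at most the full sum. *)
have eN n : wnorm W (e n) <= (E n.+1 - E n) * S.
  apply: wnorm_le => //; first by rewrite mulr_ge0 ?subr_ge0 ?sqrtr_ge0.
  rewrite exprMn sqr_sqrtr ?sumr_ge0//; last by move=> a _; rewrite invr_ge0.
  rewrite mulr_sumr; apply: ler_sum => a _.
  have [->|Wa] := eqVneq (W a) 0; first by rewrite mul0r invr0 mulr0.
  rewrite ler_pdivlMr ?lt_def ?Wa ?W0//.
  rewrite [leLHS](_ : _ = (W a * e n a) ^+ 2); last by ring.
  rewrite ler_pXn2r ?nnegrE ?mulr_ge0 ?subr_ge0//.
  apply: le_trans (We n); rewrite (bigD1 a)//= lerDl sumr_ge0// => b _.
  by rewrite mulr_ge0.
apply: (@contraction_cvg0 _ _ (fun n => (E n.+1 - E n) * S) nu) => //.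
- by move=> n; exact: wnorm_ge0.
- move=> n; rewrite -!(eq_wnorm_bproj (Vv _)).
  by apply: le_trans (wnorm_bproj_tau _ gap) _; rewrite lerD2l; exact: eN.
- by rewrite -[X in _ --> X](mul0r S); apply: cvgM => //; exact: cvg_cst.
Qed.

(** The normalisation [v_norm] combined with [1 + t <= expR t]. *)
Lemma bmean_le0 n k : bmean (v n) k <= 0.
Proof.
rewrite /bmean; set S := \sum_(b | _) W b * _.
apply: mulr_le0_ge0; last by rewrite invr_ge0 sumr_ge0.
have : \sum_(a | bl a == k) W a * (pw k * v n a) <= 0.
  rewrite -[leRHS](v_norm n k); apply: ler_sum => a _; rewrite ler_wpM2l//.
  by rewrite lerBrDl; exact: expR_ge1Dx.
under eq_bigr do rewrite mulrCA.
by rewrite -mulr_sumr pmulr_rle0.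
Qed.

(** If the mean were below [- c], every point of nonzero weight in the block would be negative, and
    so would the sum in [v_norm]. *)
Lemma bmean_ge n a c : W a != 0 ->
  (forall b, W b != 0 -> `|bproj (v n) b| <= c) -> - c <= bmean (v n) (bl a).
Proof.
move=> Wa tc; rewrite leNgt; apply/negP => lt.
have neg b : bl b == bl a -> W b != 0 -> v n b < 0.
  move=> /eqP ba Wb; have := tc b Wb; rewrite /bproj ba ler_norml => /andP[_].
  by lra.
suff : \sum_(b | bl b == bl a) W b * (expR (pw (bl a) * v n b) - 1) < 0.
  by rewrite v_norm ltxx.
rewrite (bigD1 a)//=; apply: ltr_wnDr.
  apply: sumr_le0 => b /andP[ba _]; have [->|Wb] := eqVneq (W b) 0.
    by rewrite mul0r.
  apply: mulr_ge0_le0 => //; rewrite subr_le0 expR_le1.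
  by rewrite pmulr_rle0// ltW// neg.
have Wa0 : 0 < W a by rewrite lt_def Wa W0.
rewrite (pmulr_rlt0 _ Wa0) subr_lt0 expR_lt1 pmulr_rlt0//.
exact: neg.
Qed.

Lemma wnorm_cvg0 : (fun n => wnorm W (v n)) @ \oo --> (0 : R).
Proof.
pose S := Num.sqrt (\sum_a (W a)^-1); pose M := Num.sqrt (\sum_a W a).
(* The factor 2 accounts for the deviation and the block mean, each at most
   [S * wnorm W (bproj (v n))]. *)
pose r n := 2 * (S * wnorm W (bproj (v n))) * M.
have rcv : r @ \oo --> (0 : R).
  rewrite -[X in _ --> X](mul0r M); apply: cvgM; last exact: cvg_cst.
  rewrite -[X in _ --> X](mulr0 2); apply: cvgM; first exact: cvg_cst.
  rewrite -[X in _ --> X](mulr0 S); apply: cvgM; first exact: cvg_cst.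
  exact: wnorm_bproj_cvg0.
apply: (@squeeze_cvgr _ _ _ _ (fun=> 0) r) => //; last exact: cvg_cst.
near=> n; rewrite wnorm_ge0/= /r; set c := S * _.
have c0 : 0 <= c by rewrite mulr_ge0 ?sqrtr_ge0 ?wnorm_ge0.
apply: wnorm_const_le => //; first by rewrite mulr_ge0.
have tc b : W b != 0 -> `|bproj (v n) b| <= c by exact: coord_le_wnorm.
move=> a Wa; have := bmean_ge Wa tc; have := bmean_le0 n (bl a); have := tc a Wa.
by rewrite /bproj !ler_norml => /andP[] ? ? ? ?; apply/andP; split; lra.
Unshelve. all: by end_near. Qed.

Hypothesis tau_quad : exists C delta, 0 <= C /\ 0 < delta /\
  forall v s a, 0 <= s <= delta -> (forall b, `|v b| <= s) ->
  tau v a <= Kop v a + C * s ^+ 2.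

(** Inserting the quadratic bound on [expR] in [v_norm] bounds the mean from below; the upper side
    is [bmean_le0]. *)
Lemma bmean_quad n s a P : W a != 0 -> (forall b, `|v n b| <= s) ->
  (forall k, pw k <= P) -> P * s <= 2^-1 ->
  `|bmean (v n) (bl a)| <= 2 * P * s ^+ 2.
Proof.
move=> Wa vs pP Ps.
have s0 : 0 <= s by apply: le_trans (vs a); exact: normr_ge0.
have P0 : 0 <= P by apply: le_trans (ltW (pw0 (bl a))) (pP _).
set k := bl a.
have pk := pw0 k.
suff h : - (2 * P * s ^+ 2) <= bmean (v n) k.
  rewrite ler_norml h/= (le_trans (bmean_le0 n k))//.
  by rewrite !mulr_ge0// sqr_ge0.
rewrite /bmean ler_pdivlMr ?bsum_gt0// -(ler_pM2l pk).
rewrite mulr_sumr !mulr_sumr -subr_ge0 -sumrB.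
rewrite -[leLHS](v_norm n k).
apply: ler_sum => b _.
have pv : `|pw k * v n b| <= P * s.
  by rewrite normrM ler_pM// gtr0_norm.
have : expR (pw k * v n b) <= _ := expR_le_quad (le_trans (ler_norm _) (le_trans pv Ps)).
(* One factor [pw k] is kept and the other bounded by [P], so that [pw k] cancels in the end. *)
have : (pw k * v n b) ^+ 2 <= pw k * (P * s ^+ 2).
  rewrite exprMn expr2 -mulrA (ler_wpM2l (ltW pk))//.
  apply: ler_pM; rewrite ?sqr_ge0 ?(ltW pk) ?pP//.
  by rewrite -[v n b ^+ 2]real_normK ?num_real// ler_pXn2r ?nnegrE.
move=> h1 h2.
have -> : pw k * (W b * v n b) - pw k * (- (2 * P * s ^+ 2) * W b) =
   W b * (pw k * v n b + 2 * (pw k * (P * s ^+ 2))) by ring.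
by apply: ler_wpM2l => //; lra.
Qed.

(** The relative error [expR v - 1] is compared with [v], whose deviations contract and whose block
    means are of second order. *)
Lemma linear_rate : exists nu, 0 < nu < 1 /\ exists N, forall n, (N <= n)%N ->
  wnorm W (fun a => expR (v n.+1 a) - 1) <= nu * wnorm W (fun a => expR (v n a) - 1).
Proof.
have [nu nu01 gap] := kop_gap K0 KC KW Kdiag Kconn.
have [C [delta [C0 [delta0 quad]]]] := tau_quad.
pose b n := wnorm W (v n).
pose S := Num.sqrt (\sum_a (W a)^-1); pose M := Num.sqrt (\sum_a W a).
pose P := 1 + \sum_k pw k.
have S0 : 0 <= S := sqrtr_ge0 _. have M0 : 0 <= M := sqrtr_ge0 _.
have P0 : 1 <= P by rewrite lerDl sumr_ge0// => k _; exact: ltW.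
have pP k : pw k <= P.
  by rewrite /P (bigD1 k)//= addrCA lerDl addr_ge0// sumr_ge0// => j _; exact: ltW.
have b0 n : 0 <= b n := wnorm_ge0 _ _.
have vs n a : `|v n a| <= S * b n.
  have [Wa|Wa] := eqVneq (W a) 0; last exact: coord_le_wnorm.
  by rewrite v_supp// normr0 mulr_ge0.
(* Below [delta] the bound on [tau] holds; below [(2 * P)^-1] so do [bmean_quad] and, as [P >= 1],
   [expR_le_quad]. *)
pose c := Num.min delta (2 * P)^-1.
have c0 : 0 < c by rewrite lt_min delta0/= invr_gt0; lra.
have sc0 : 0 < c / (S + 1) by rewrite divr_gt0// ltr_wpDl.
have [N HN] := cvg0_eventually_le wnorm_cvg0 sc0.
have small n : (N <= n)%N -> S * b n <= c.
  move=> /HN; rewrite -/(b n) ler_pdivlMr ?ltr_wpDl// => h.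
  have := b0 n; lra.
have smallP n : (N <= n)%N -> P * (S * b n) <= 2^-1.
  move=> /small/le_trans h.
  have hc : S * b n <= (2 * P)^-1 by apply: h; rewrite ge_min lexx orbT.
  have P00 : 0 < P by lra.
  by rewrite -ler_pdivlMl// (le_trans hc)// invfM mulrC.
(* One constant for three second-order errors: [C] for [tau - Kop], [2 * P] for the block means, 2
   for [expR v - 1 - v]. *)
pose L := (C + 2 * P + 2) * S ^+ 2 * M.
have leL x n : x <= C + 2 * P + 2 -> x * (S * b n) ^+ 2 * M <= L * b n ^+ 2.
  move=> xL; rewrite (_ : _ * M = x * (S ^+ 2 * M * b n ^+ 2)); last by ring.
  rewrite (_ : L * _ = (C + 2 * P + 2) * (S ^+ 2 * M * b n ^+ 2)); last first.
    by rewrite /L; ring.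
  by apply: ler_wpM2r => //; rewrite !mulr_ge0// sqr_ge0.
apply: (@quadratic_perturbation_rate _ _ b nu L N) => //.
- by rewrite !mulr_ge0 ?sqr_ge0//; lra.
- exact: wnorm_cvg0.
- move=> n Nn.
  have h1 : b n.+1 <= wnorm W (bproj (v n.+1)) + wnorm W (fun a => bmean (v n.+1) (bl a)).
    rewrite /b -[v n.+1 in leLHS](_ :
      (fun a => bproj (v n.+1) a + bmean (v n.+1) (bl a)) = _).
      exact: ler_wnormD.
    by apply/funext => a; rewrite subrK.
  have h2 : wnorm W (fun a => bmean (v n.+1) (bl a)) <= 2 * P * (S * b n.+1) ^+ 2 * M.
    apply: wnorm_const_le => //; first by rewrite mulr_ge0 ?sqr_ge0//; lra.
    by move=> a Wa; apply: bmean_quad => //; exact: smallP (leqW Nn).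
  have h3 : wnorm W (bproj (v n.+1)) <=
      nu * b n + wnorm W (fun a => tau (v n) a - Kop (v n) a).
    rewrite (eq_wnorm_bproj (v_step n)); apply: le_trans (wnorm_bproj_tau _ gap) _.
    by rewrite lerD2r ler_wpM2l ?wnorm_bproj//; case/andP: nu01.
  have h4 : wnorm W (fun a => tau (v n) a - Kop (v n) a) <= C * (S * b n) ^+ 2 * M.
    apply: wnorm_const_le => //; first by rewrite mulr_ge0 ?sqr_ge0.
    move=> a Wa; rewrite ger0_norm ?subr_ge0// lerBlDl.
    apply: quad => //; rewrite mulr_ge0//=.
    by apply: le_trans (small _ Nn) _; rewrite ge_min lexx.
  have h5 : 2 * P * (S * b n.+1) ^+ 2 * M <= L * b n.+1 ^+ 2.
    by apply: leL; lra.
  have h6 : C * (S * b n) ^+ 2 * M <= L * b n ^+ 2.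
    by apply: leL; lra.
  lra.
- move=> n Nn.
  have h : wnorm W (fun a => (expR (v n a) - 1) - v n a) <= L * b n ^+ 2.
    apply: le_trans (_ : 2 * (S * b n) ^+ 2 * M <= _).
      apply: wnorm_const_le => //; first by rewrite mulr_ge0 ?sqr_ge0.
      move=> a Wa; have va := vs n a.
      have va2 : v n a ^+ 2 <= (S * b n) ^+ 2.
        by rewrite -[v n a ^+ 2]real_normK ?num_real// ler_pXn2r ?nnegrE ?mulr_ge0.
      have vh : v n a <= 2^-1.
        apply: le_trans (ler_norm _) (le_trans va _).
        apply: le_trans (smallP _ Nn); rewrite ler_peMl// mulr_ge0//.
      have := expR_le_quad vh; have := expR_ge1Dx (v n a).
      by move=> ? ?; rewrite ger0_norm; lra.
    by apply: leL; lra.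
  apply: le_trans h; rewrite ler_norml; apply/andP; split.
    rewrite lerNl opprB lerBlDr.
    have -> : wnorm W (fun a => expR (v n a) - 1 - v n a) =
              wnorm W (fun a => v n a - (expR (v n a) - 1)).
      have := wnormZ W (-1) (fun a => v n a - (expR (v n a) - 1)).
      rewrite normrN1 mul1r => <-; congr wnorm; apply/funext => a; ring.
    rewrite /b -[v n in leLHS](_ :
      (fun a => (v n a - (expR (v n a) - 1)) + (expR (v n a) - 1)) = _).
      exact: ler_wnormD.
    by apply/funext => a; rewrite subrK.
  rewrite lerBlDr /b.
  apply: le_trans (ler_wnormD W0 _ _); rewrite le_eqVlt; apply/orP; left; apply/eqP.
  by congr wnorm; apply/funext => a; rewrite subrK.
Qed.

End Dynamics.

(** * Log-sum-exp *)

Section LogSumExp.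
Variables (R : realType) (T : finType).
Implicit Types (th u : T -> R).

Definition lse th u : R := ln ((\sum_J th J * expR (u J)) / \sum_J th J).

Variable th : T -> R.
Hypothesis th0 : forall J, 0 <= th J.
Hypothesis thS : 0 < \sum_J th J.

Lemma sum_expR_gt0 u : 0 < \sum_J th J * expR (u J).
Proof.
have [J thJ] : exists J, 0 < th J.
  apply/existsP; apply: contraLR thS => /existsPn h.
  by rewrite -leNgt; apply: sumr_le0 => J _; rewrite leNgt.
rewrite (bigD1 J)//= ltr_pwDl ?mulr_gt0 ?expR_gt0//.
by apply: sumr_ge0 => J' _; rewrite mulr_ge0 ?expR_ge0.
Qed.

Lemma expR_lse u : (\sum_J th J) * expR (lse th u) = \sum_J th J * expR (u J).
Proof. by rewrite lnK ?posrE ?divr_gt0 ?sum_expR_gt0// mulrC divfK// gt_eqF. Qed.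

Lemma le_lse u u' c : (forall J, th J != 0 -> u J <= u' J + c) ->
  lse th u <= lse th u' + c.
Proof.
move=> uu'; rewrite -ler_expR expRD -(ler_pM2l thS) mulrA !expR_lse mulr_suml.
apply: ler_sum => J _; have [->|tJ] := eqVneq (th J) 0; first by rewrite !mul0r.
by rewrite -mulrA -expRD ler_wpM2l// ler_expR uu'.
Qed.

Lemma lseD u u' c : (forall J, th J != 0 -> u J = u' J + c) ->
  lse th u = lse th u' + c.
Proof.
move=> uu'; apply: le_anti; rewrite le_lse => [|J /uu' ->//]; rewrite andTb.
by rewrite -lerBrDr; apply: le_lse => J /uu' ->; rewrite addrK.
Qed.

Lemma lse0 : lse th (fun=> 0) = 0.
Proof.
rewrite /lse; under eq_bigr do rewrite expR0 mulr1.
by rewrite divff ?ln1// gt_eqF.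
Qed.

Lemma lse_le u c : (forall J, th J != 0 -> u J <= c) -> lse th u <= c.
Proof. by move=> h; rewrite -[c]add0r -lse0; apply: le_lse => J /h; rewrite add0r. Qed.

Lemma lse_norm u c : (forall J, th J != 0 -> `|u J| <= c) -> `|lse th u| <= c.
Proof.
move=> h; rewrite ler_norml lse_le; last by move=> J /h; exact/le_trans/ler_norm.
rewrite andbT -[- c]add0r -lse0 lerBlDr; apply: le_lse => J /h.
by rewrite ler_norml -lerBlDr sub0r => /andP[].
Qed.

(** Jensen through the tangent line at the mean [M]: [expR u >= expR M * (1 + u - M)], and the
    right-hand side averages to [expR M]. *)
Lemma lse_ge_mean u : (\sum_J th J * u J) / (\sum_J th J) <= lse th u.
Proof.
set M := _ / _; rewrite -ler_expR -(ler_pM2l thS) expR_lse.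
rewrite [leLHS](_ : _ = expR M * \sum_J th J * (1 + u J - M)).
  rewrite mulr_sumr; apply: ler_sum => J _; rewrite mulrCA ler_wpM2l//.
  rewrite -[X in _ <= expR X](subrK M) expRD mulrC ler_wpM2r ?expR_ge0//.
  by rewrite -addrA; exact: expR_ge1Dx.
have MS : M * \sum_J th J = \sum_J th J * u J by rewrite divfK// gt_eqF.
rewrite mulrC; congr (_ * _).
rewrite -[LHS](addrK (M * \sum_J th J)) {1}MS mulr_sumr -big_split -sumrB/=.
by apply: eq_bigr => J _; ring.
Qed.

(** With [t] the right-hand side, the mean of [expR u] is at most [1 + t], which is at most
    [expR t]. *)
Lemma lse_quad u s : (forall J, `|u J| <= s) -> s <= 2^-1 ->
  lse th u <= (\sum_J th J * u J) / (\sum_J th J) + 2 * s ^+ 2.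
Proof.
move=> us s2; have nz : \sum_J th J != 0 by rewrite gt_eqF.
have h : (\sum_J th J * expR (u J)) / (\sum_J th J) <=
    1 + ((\sum_J th J * u J) / (\sum_J th J) + 2 * s ^+ 2).
  rewrite ler_pdivrMr// mulrDl mul1r mulrDl divfK// mulr_sumr -!big_split/=.
  apply: ler_sum => J _; rewrite -mulrC.
  have := expR_le_quad (le_trans (ler_norm _) (le_trans (us J) s2)).
  have : u J ^+ 2 <= s ^+ 2.
    rewrite -[u J ^+ 2]real_normK ?num_real// ler_pXn2r ?nnegrE//.
    exact: le_trans (us J).
  move=> h1 h2; have h3 : expR (u J) <= 1 + u J + 2 * s ^+ 2 by lra.
  by have := ler_wpM2r (th0 J) h3; lra.
have p0 : 0 < (\sum_J th J * expR (u J)) / (\sum_J th J).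
  by rewrite divr_gt0// sum_expR_gt0.
rewrite -(ler_expR) lnK ?posrE//; apply: le_trans h _; exact: expR_ge1Dx.
Qed.

End LogSumExp.

(** * Kernels of weighted multi-indices *)

Section Tensor.
Variables (R : realType) (m : nat) (d : 'I_m -> nat).
Local Notation MI := (MI d).
Local Notation V := {k : 'I_m & 'I_(d k)}.
Implicit Types (J : MI) (a b : V).

(** A multi-index is viewed as a hyperedge meeting each block in exactly one vertex; [inc] is
    incidence. *)
Definition vtx J (k : 'I_m) : V := Tagged (fun k => 'I_(d k)) (J k).

Definition inc J a : bool := J (tag a) == tagged a.

Lemma inc_vtx J k : inc J (vtx J k).
Proof. exact: eqxx. Qed.

Lemma inc_tag J a b : inc J a -> inc J b -> tag a = tag b -> a = b.
Proof.
by case: a b => [k j] [k' j'] /eqP/= <- /eqP/= <- kk'; move: kk' => <-.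
Qed.

Lemma sum_inc (P : pred 'I_m) J (G : V -> R) :
  \sum_(a | P (tag a) && inc J a) G a = \sum_(k | P k) G (vtx J k).
Proof.
rewrite [RHS](eq_bigr (fun k => \sum_(j | J k == j) G (Tagged (fun k => 'I_(d k)) j))).
  rewrite (@sig_big_dep _ _ _ _ _ P (fun k (j : 'I_(d k)) => J k == j)
    (fun k j => G (Tagged (fun k => 'I_(d k)) j))) /=.
  by apply: eq_bigr => -[k j].
by move=> k _; rewrite (eq_bigl (pred1 (J k))) ?big_pred1_eq.
Qed.

Variables (i : 'I_m) (mu : MI -> R) (q : R) (p : 'I_m -> R).

(** With [mu] read as an unnormalised probability on multi-indices, [mg] and [mg2] are its one- and
    two-vertex marginals, and [cond a] is its restriction to the multi-indices through [a]. *)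
Definition mg a := \sum_(J | inc J a) mu J.
Definition mg2 a b := \sum_(J | inc J a && inc J b) mu J.
Definition cond a J := if inc J a then mu J else 0.
Definition offsum (v : V -> R) J := \sum_(k | k != i) v (vtx J k).
(** Logarithm of the factor gained by [grad f i] at [c] when [xs] becomes [xs * expR v], see
    [grad_i_expR]; [ell] is the resulting exponent of the term [J] in the gradient of block
    [tag a]. *)
Definition lam v c := lse (cond c) (offsum v).
Definition ell v a J := (q - 1) * lam v (vtx J i)
  + \sum_(k | (k != i) && (k != tag a)) v (vtx J k).
(* One HGPM step sends [xs * expR v] to a blockwise multiple of
   [xs * expR (logmap v)], see [sHG_expR].  The block [i], absent from R^{d-d_i},
   stays in the index type with value and weight 0. *)
Definition logmap v a :=
  if tag a == i then 0 else lse (cond a) (ell v a) / (p (tag a) - 1).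

Definition Wt a := if tag a == i then 0 else (p (tag a) - 1) * mg a.
(* [kop Wt Kt] is the derivative of [logmap] at 0. *)
Definition Kt a b := if (tag a != i) && (tag b != i) then
  (q - 1) * (\sum_(c | tag c == i) mg2 a c * mg2 b c / mg c)
  + (if tag b != tag a then mg2 a b else 0) else 0.

(** First-order parts of [lam] and [ell] at [v = 0]. *)
Definition cmean v c := (\sum_(J | inc J c) mu J * offsum v J) / mg c.
Definition ell0 v a J := (q - 1) * cmean v (vtx J i)
  + \sum_(k | (k != i) && (k != tag a)) v (vtx J k).

Lemma sum_cond a (G : MI -> R) :
  \sum_J cond a J * G J = \sum_(J | inc J a) mu J * G J.
Proof.
rewrite [RHS]big_mkcond; apply: eq_bigr => J _; rewrite /cond.
by case: ifP => // _; rewrite mul0r.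
Qed.

Lemma sum_cond1 a : \sum_J cond a J = mg a.
Proof. by rewrite /mg [RHS]big_mkcond. Qed.

Lemma mg2C a b : mg2 a b = mg2 b a.
Proof. by apply: eq_bigl => J; rewrite andbC. Qed.

Lemma sum_mg2 (P : pred 'I_m) a (G : V -> R) :
  \sum_(b | P (tag b)) mg2 a b * G b =
  \sum_(J | inc J a) mu J * \sum_(k | P k) G (vtx J k).
Proof.
rewrite (eq_bigr (fun b => \sum_(J | inc J a) if inc J b then mu J * G b else 0)).
  rewrite exchange_big/=; apply: eq_bigr => J _.
  by rewrite -big_mkcondr -mulr_sumr sum_inc.
by move=> b _; rewrite mulr_suml big_mkcondr.
Qed.

(** The first part of [Kt] passes from [a] to [b] through a vertex of block [i] and produces the
    nested mean [cmean]; the second is the direct co-occurrence of [a] and [b]. *)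
Lemma sum_Kt v a : tag a != i ->
  \sum_b Kt a b * v b = \sum_(J | inc J a) mu J * ell0 v a J.
Proof.
move=> ai; transitivity (\sum_(b | tag b != i)
    ((q - 1) * (\sum_(c | tag c == i) mg2 a c * mg2 b c / mg c * v b)
    + (if tag b != tag a then mg2 a b * v b else 0))).
  rewrite [RHS]big_mkcond; apply: eq_bigr => b _; rewrite /Kt ai/=.
  case: ifP => _; last by rewrite mul0r.
  rewrite mulrDl -mulrA mulr_suml; congr (_ + _).
  by case: ifP => // _; rewrite mul0r.
rewrite big_split/= -mulr_sumr -big_mkcondr/=.
rewrite (sum_mg2 (fun k => (k != i) && (k != tag a))) exchange_big/=.
rewrite (eq_bigr (fun c => mg2 a c * cmean v c)); last first.
  move=> c ci; rewrite /cmean -(sum_mg2 (fun k => k != i) c) mulr_suml mulr_sumr.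
  by apply: eq_bigr => b _; rewrite (mg2C c); ring.
rewrite (sum_mg2 (pred1 i)) mulr_sumr -big_split/=; apply: eq_bigr => J _.
by rewrite big_pred1_eq /ell0; ring.
Qed.

Hypothesis mu0 : forall J, 0 <= mu J.
Hypothesis mgp : forall a, 0 < mg a.
Hypothesis q1 : 1 < q.
Hypothesis p1 : forall k, 1 < p k.
Hypothesis pq : forall k, k != i -> (m.-1)%:R * q <= p k.
Hypothesis m2 : (2 <= m)%N.

Let q0 : 0 <= q - 1. Proof. by rewrite subr_ge0 ltW. Qed.
Let p0 k : 0 < p k - 1. Proof. by rewrite subr_gt0. Qed.

Lemma cond_ge0 a J : 0 <= cond a J.
Proof. by rewrite /cond; case: ifP. Qed.

Lemma sum_cond_gt0 a : 0 < \sum_J cond a J.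
Proof. by rewrite sum_cond1. Qed.

Lemma mg2_ge0 a b : 0 <= mg2 a b.
Proof. exact: sumr_ge0. Qed.

Lemma KtC a b : Kt a b = Kt b a.
Proof.
rewrite /Kt andbC; case: ifP => // _; rewrite eq_sym (mg2C a b); congr (_ * _ + _).
by apply: eq_bigr => c _; rewrite (mulrC (mg2 a c)).
Qed.

Lemma Kt_ge0 a b : 0 <= Kt a b.
Proof.
rewrite /Kt; case: ifP => // _; rewrite addr_ge0 ?mulr_ge0//.
  by apply: sumr_ge0 => c _; rewrite !mulr_ge0 ?mg2_ge0// invr_ge0 ltW.
by case: ifP => // _; exact: mg2_ge0.
Qed.

Lemma sum_const_off (x : R) : \sum_(k < m | k != i) x = (m.-1)%:R * x.
Proof.
by rewrite sumr_const cardC1 card_ord mulr_natl.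
Qed.

Lemma sum_const_off2 l (x : R) : l != i ->
  \sum_(k < m | (k != i) && (k != l)) x = (m.-1)%:R * x - x.
Proof.
move=> li; have := sum_const_off x; rewrite (bigD1 l)//= => <-.
by rewrite [x + _]addrC addrK.
Qed.

(** For the constant 1, [ell0] equals [(q - 1) (m - 1) + (m - 2) = (m - 1) q - 1], at most
    [p (tag a) - 1]: here the exponent condition enters. *)
Lemma Kt_sum a : \sum_b Kt a b <= Wt a.
Proof.
rewrite /Wt; case: ifP => ai; first by rewrite big1// => b _; rewrite /Kt ai.
have {}ai : tag a != i by rewrite ai.
rewrite (eq_bigr (fun b => Kt a b * 1)) ?sum_Kt//; last by move=> ? _; rewrite mulr1.
rewrite (eq_bigr (fun J => mu J * ((m.-1)%:R * q - 1))).
  rewrite -mulr_suml mulrC ler_pM2r ?mgp// lerD2r; exact: pq.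
move=> J _; congr (_ * _); rewrite /ell0 sum_const_off2// /cmean.
rewrite (eq_bigr (fun J => mu J * (m.-1)%:R)); last first.
  by move=> J' _; rewrite /offsum sum_const_off mulr1.
rewrite -mulr_suml mulrAC divff ?gt_eqF ?mgp//; ring.
Qed.

Lemma cmean_const (c : 'I_m -> R) a :
  cmean (fun b => c (tag b)) a = \sum_(k | k != i) c k.
Proof.
rewrite /cmean (eq_bigr (fun J => mu J * \sum_(k | k != i) c k))//.
by rewrite -mulr_suml mulrAC divff ?mul1r// gt_eqF ?mgp.
Qed.

Lemma kop_Kt v a : tag a != i -> kop Wt Kt v a =
  (\sum_(J | inc J a) mu J * ell0 v a J) / mg a / (p (tag a) - 1).
Proof.
move=> ai; rewrite /kop sum_Kt// /Wt (negbTE ai) invfM; ring.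
Qed.

Lemma kop_Kt_i v a : tag a == i -> kop Wt Kt v a = 0.
Proof. by move=> ai; rewrite /kop /Wt ai invr0 mulr0. Qed.

Lemma kop_Kt_bconst (c : 'I_m -> R) :
  bconst (fun a : V => tag a) (kop Wt Kt (fun a => c (tag a))).
Proof.
move=> a b ab; have [ai|ai] := eqVneq (tag a) i.
  by rewrite !kop_Kt_i// -?ab ?ai.
have h e : tag e != i -> kop Wt Kt (fun a => c (tag a)) e =
    ((q - 1) * (\sum_(k | k != i) c k)
     + \sum_(k | (k != i) && (k != tag e)) c k) / (p (tag e) - 1).
  move=> ei; rewrite kop_Kt//; congr (_ / _).
  rewrite (eq_bigr (fun J => mu J * ((q - 1) * (\sum_(k | k != i) c k)
     + \sum_(k | (k != i) && (k != tag e)) c k))).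
    by rewrite -mulr_suml mulrAC divff ?mul1r// gt_eqF ?mgp.
  by move=> J _; rewrite /ell0 cmean_const.
by rewrite !h -?ab.
Qed.

Lemma lam_ge v c : cmean v c <= lam v c.
Proof.
rewrite /cmean -sum_cond -sum_cond1; apply: lse_ge_mean; first exact: cond_ge0.
exact: sum_cond_gt0.
Qed.

(** Jensen at both levels; the inner inequality survives because its coefficient [q - 1] is
    nonnegative. *)
Lemma logmap_ge v a : kop Wt Kt v a <= logmap v a.
Proof.
rewrite /logmap; case: ifPn => ai; first by rewrite kop_Kt_i.
rewrite kop_Kt// ler_pM2r ?invr_gt0//.
apply: le_trans (lse_ge_mean (cond_ge0 a) (sum_cond_gt0 a) _).
rewrite sum_cond sum_cond1 ler_pM2r ?invr_gt0//; apply: ler_sum => J _.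
by rewrite ler_wpM2l// lerD2r ler_wpM2l// lam_ge.
Qed.

Lemma logmap_le0 v : (forall a, v a <= 0) -> forall a, logmap v a <= 0.
Proof.
move=> v0 a; rewrite /logmap; case: ifP => // _.
apply: mulr_le0_ge0; last by rewrite invr_ge0 ltW.
apply: lse_le; [exact: cond_ge0|exact: sum_cond_gt0|move=> J _].
rewrite -[leRHS](addr0 0); apply: lerD; last exact: sumr_le0.
apply: mulr_ge0_le0 => //; apply: lse_le; [exact: cond_ge0|exact: sum_cond_gt0|].
by move=> J' _; exact: sumr_le0.
Qed.

(** A block-constant shift adds the same amount to the exponents of all multi-indices, and [lse]
    commutes with translations. *)
Lemma logmap_bconst u v : bconst (fun a : V => tag a) (fun a => u a - v a) ->
  bconst (fun a : V => tag a) (fun a => logmap u a - logmap v a).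
Proof.
move=> cuv.
(* A multi-index supplies a reference vertex in each block; without one all marginals would
   vanish. *)
have [J0|noJ] := pselect (exists J0 : MI, True); last first.
  by move=> a; have := mgp a; rewrite /mg big1 ?ltxx// => J; case: noJ; exists J.
case: J0 => J0 _; pose c k := u (vtx J0 k) - v (vtx J0 k).
have uE a : u a = v a + c (tag a) by rewrite /c -(cuv a (vtx J0 (tag a)))// addrC subrK.
clearbody c.
have lE e : lam u e = lam v e + \sum_(k | k != i) c k.
  apply: lseD; [exact: cond_ge0|exact: sum_cond_gt0|move=> J _].
  by rewrite /offsum -big_split/=; apply: eq_bigr => k _; rewrite uE.
have tE a : tag a != i -> logmap u a - logmap v a = ((q - 1) * (\sum_(k | k != i) c k) +
   \sum_(k | (k != i) && (k != tag a)) c k) / (p (tag a) - 1).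
  move=> ai; rewrite /logmap (negbTE ai) -mulrBl; congr (_ / _).
  apply/eqP; rewrite subr_eq [_ + lse _ _]addrC; apply/eqP.
  apply: lseD; [exact: cond_ge0|exact: sum_cond_gt0|move=> J _].
  have -> : ell u a J = (q - 1) * (lam v (vtx J i) + \sum_(k | k != i) c k)
      + \sum_(k | (k != i) && (k != tag a)) (v (vtx J k) + c k).
    by rewrite /ell lE; congr (_ + _); apply: eq_bigr => k _; rewrite uE.
  by rewrite /ell big_split/=; ring.
move=> a b ab; have [ai|ai] := eqVneq (tag a) i.
  by rewrite /logmap -ab ai eqxx.
by rewrite !tE -?ab.
Qed.

Lemma sum_norm_le (P : pred 'I_m) (v : V -> R) s J : 0 <= s -> (forall b, `|v b| <= s) ->
  `|\sum_(k | P k) v (vtx J k)| <= m%:R * s.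
Proof.
move=> s0 vs; apply: le_trans (ler_norm_sum _ _ _) _.
rewrite big_mkcond; apply: (@le_trans _ _ (\sum_(k < m) s)).
  by apply: ler_sum => k _; case: ifP.
by rewrite sumr_const card_ord mulr_natl.
Qed.

Lemma lam_norm v s c : 0 <= s -> (forall b, `|v b| <= s) -> `|lam v c| <= m%:R * s.
Proof.
move=> s0 vs; apply: lse_norm; [exact: cond_ge0|exact: sum_cond_gt0|move=> J _].
exact: sum_norm_le.
Qed.

Lemma ell_norm v s a J : 0 <= s -> (forall b, `|v b| <= s) ->
  `|ell v a J| <= q * m%:R * s.
Proof.
move=> s0 vs; rewrite (_ : q * _ * s = (q - 1) * (m%:R * s) + m%:R * s); last by ring.
apply: le_trans (ler_normD _ _) _; apply: lerD; last exact: sum_norm_le.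
by rewrite normrM (ger0_norm q0) ler_wpM2l// lam_norm.
Qed.

Lemma logmap_norm v s a : 0 <= s -> (forall b, `|v b| <= s) ->
  `|logmap v a| <= q * m%:R * s / (p (tag a) - 1).
Proof.
move=> s0 vs; rewrite /logmap; case: ifP => _.
  by rewrite normr0 !mulr_ge0// ?invr_ge0 ?(ltW (p0 _))// (le_trans _ (ltW q1)).
rewrite normrM normfV (gtr0_norm (p0 _)) ler_pM2r ?invr_gt0//.
apply: lse_norm; [exact: cond_ge0|exact: sum_cond_gt0|move=> J _].
exact: ell_norm.
Qed.

Lemma lam_quad v s c : 0 <= s -> (forall b, `|v b| <= s) -> m%:R * s <= 2^-1 ->
  lam v c <= cmean v c + 2 * (m%:R * s) ^+ 2.
Proof.
move=> s0 vs ms; rewrite /cmean -sum_cond -sum_cond1.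
apply: lse_quad => //; [exact: cond_ge0|exact: sum_cond_gt0|move=> J].
exact: sum_norm_le.
Qed.

Lemma logmap_quad : exists C delta, 0 <= C /\ 0 < delta /\
  forall v s a, 0 <= s <= delta -> (forall b, `|v b| <= s) ->
  logmap v a <= kop Wt Kt v a + C * s ^+ 2.
Proof.
pose Q := q * m%:R.
have m0 : 0 < m%:R :> R by rewrite ltr0n ltnW.
have Q0 : 0 < Q by rewrite mulr_gt0// (lt_trans _ q1).
have mQ : m%:R <= Q by rewrite ler_peMl// ltW.
(* The inner [lse] has exponents at most [m * s], and its error is multiplied by [q - 1]; the outer
   one has exponents at most [Q * s]. *)
pose C0 := (q - 1) * (2 * m%:R ^+ 2) + 2 * Q ^+ 2.
have C00 : 0 <= C0.
  by apply: addr_ge0; apply: mulr_ge0 => //; exact: sqr_ge0.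
pose C := \sum_k C0 / (p k - 1).
have Ck k : 0 <= C0 / (p k - 1) by rewrite divr_ge0// ltW.
exists C, (2 * Q)^-1; split; first exact: sumr_ge0.
split; first by rewrite invr_gt0 mulr_gt0.
move=> v s a /andP[s0 sd] vs.
have Qs : Q * s <= 2^-1.
  by rewrite -ler_pdivlMl// (le_trans sd)// invfM mulrC.
have ms : m%:R * s <= 2^-1 by apply: le_trans Qs; rewrite ler_wpM2r.
have [ai|ai] := eqVneq (tag a) i.
  by rewrite kop_Kt_i ?ai// /logmap ai eqxx add0r mulr_ge0 ?sqr_ge0// sumr_ge0.
apply: (@le_trans _ _ (kop Wt Kt v a + C0 / (p (tag a) - 1) * s ^+ 2)); last first.
  rewrite lerD2l ler_wpM2r ?sqr_ge0// /C (bigD1 (tag a))//= lerDl.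
  exact: sumr_ge0.
rewrite kop_Kt// /logmap (negbTE ai) [C0 / _ * _]mulrAC -mulrDl ler_pM2r ?invr_gt0//.
have := lse_quad (cond_ge0 a) (sum_cond_gt0 a) (fun J => ell_norm a J s0 vs) Qs.
move/le_trans; apply; rewrite sum_cond sum_cond1.
have h : \sum_(J | inc J a) mu J * ell v a J <=
    \sum_(J | inc J a) mu J * (ell0 v a J + (q - 1) * (2 * (m%:R * s) ^+ 2)).
  apply: ler_sum => J _; rewrite ler_wpM2l// /ell /ell0 addrAC lerD2r -mulrDr.
  by rewrite ler_wpM2l// lam_quad.
have := h; rewrite -(ler_pM2r (_ : 0 < (mg a)^-1)) ?invr_gt0// => {}h.
have {h} := le_trans h _; move=> h.
rewrite -lerBrDr; apply: h.
rewrite (eq_bigr (fun J => mu J * ell0 v a J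
  + mu J * ((q - 1) * (2 * (m%:R * s) ^+ 2)))); last first.
  by move=> J _; rewrite mulrDr.
rewrite big_split/= -mulr_suml mulrDl.
rewrite [X in _ + X](_ : _ = (q - 1) * (2 * (m%:R * s) ^+ 2)).
  by rewrite /C0 -/Q; lra.
by rewrite mulrAC divff ?mul1r// gt_eqF ?mgp.
Qed.

(** The vertex common to [J] and [J'] in block [i] makes the two-step part of [Kt] positive;
    [J = J'] covers a direct edge. *)
Lemma Kt_gt0 a b J J' : tag a != i -> tag b != i -> inc J a -> inc J' b ->
  J i = J' i -> 0 < mu J -> 0 < mu J' -> 0 < Kt a b.
Proof.
move=> ai bi Ja Jb JJ muJ muJ'; rewrite /Kt ai bi/=; apply: ltr_pwDl; last first.
  by case: ifP => // _; exact: mg2_ge0.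
rewrite mulr_gt0 ?subr_gt0// (bigD1 (vtx J i))//= ltr_pwDl//; last first.
  by apply: sumr_ge0 => c _; rewrite !mulr_ge0 ?mg2_ge0// invr_ge0 ltW.
have pos e J1 : inc J1 e -> J1 i = J i -> 0 < mu J1 -> 0 < mg2 e (vtx J i).
  move=> e1 e2 e3; rewrite /mg2 (bigD1 J1)/= ?e1 /inc/= ?e2 ?eqxx//.
  by rewrite ltr_pwDl// sumr_ge0.
rewrite divr_gt0//; apply: mulr_gt0; first exact: (pos a J).
exact: (pos b J' Jb (esym JJ)).
Qed.

(** Vertices of block [i] on a path are bypassed: the hyperedges before and after such a vertex
    share it, so [Kt_gt0] joins its neighbours. *)
Lemma Kt_connect (e : rel V) :
  (forall a b, e a b -> tag a != tag b /\
     exists J, [/\ inc J a, inc J b & 0 < mu J]) ->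
  (forall a b, connect e a b) ->
  forall a b, tag a != i -> tag b != i -> connect (fun a b => 0 < Kt a b) a b.
Proof.
move=> eP ec a b ai bi; have /connectP[s] := ec a b.
(* When [u] is in block [i], where [Kt] has a zero row, the induction speaks of every possible
   predecessor [w] instead. *)
suff main : forall u, path e u s -> b = last u s ->
    (tag u != i -> connect (fun a b => 0 < Kt a b) u b) /\
    (tag u = i -> forall w J, tag w != i -> inc J w -> inc J u -> 0 < mu J ->
      connect (fun a b => 0 < Kt a b) w b).
  by move=> h1 h2; have [h _] := main a h1 h2; exact: h.
elim: s => [|u' s IH] u /=.
  by move=> _ <-; split => [_|bi']; [exact: connect0 | rewrite bi' eqxx in bi].
move=> /andP[/eP[uu' [J [Ju Ju' muJ]]] pth] lst; have [H1 H2] := IH _ pth lst.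
split=> [ui|ui w J' wi J'w J'u muJ'].
  have [u'i|u'i] := eqVneq (tag u') i; first exact: (H2 u'i u J).
  by apply: connect_trans (H1 u'i); apply: connect1; exact: (@Kt_gt0 _ _ J J).
have u'i : tag u' != i by rewrite -ui eq_sym.
apply: connect_trans (H1 u'i); apply: connect1; apply: (@Kt_gt0 _ _ J' J) => //.
have := inc_tag J'u (inc_vtx J' i) ui; have := inc_tag Ju (inc_vtx J i) ui.
by move=> -> /esym/eqP; rewrite eq_Tagged => /eqP/esym.
Qed.

End Tensor.

(** * HGPM in logarithmic coordinates *)

Section LogCoordinates.
Variables (R : realType) (m : nat) (d : 'I_m -> nat).
Variables (f : MI d -> R) (p : 'I_m -> R) (i : 'I_m) (xs : mvec R m).
Local Notation V := {k : 'I_m & 'I_(d k)}.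
Implicit Types (J : MI d) (a b : V) (v : V -> R) (x : mvec R m).

Definition at_vtx x a : R := x (tag a) (tagged a).

Hypothesis m2 : (2 <= m)%N.
Hypothesis d0 : forall k, (0 < d k)%N.
Hypothesis f0 : forall J, 0 <= f J.
Hypothesis wi : weakly_irreducible f.
Hypothesis p1 : forall k, 1 < p k.
Hypothesis xs0 : forall a, tag a != i -> 0 < at_vtx xs a.

Local Notation q := (dual (p i)).
Local Notation phi := (grad f i xs).

Lemma dual_gt1 (r : R) : 1 < r -> 1 < dual r.
Proof. by move=> r1; rewrite /dual ltr_pdivlMr ?subr_gt0// mul1r; lra. Qed.

Lemma dualB1 (r : R) : 1 < r -> dual r - 1 = (r - 1)^-1.
Proof.
move=> r1; have : r - 1 != 0 by rewrite gt_eqF// subr_gt0.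
by move=> h; rewrite /dual; field.
Qed.

Lemma edge_inc a b : wi_edge f a b -> tag a != tag b /\
  exists J, [/\ inc J a, inc J b & 0 < f J].
Proof.
by move=> /andP[ab /existsP[J /and3P[Ja Jb fJ]]]; split=> //; exists J.
Qed.

(** Another block exists and is nonempty; the first edge of a path to it carries a positive entry
    through [a]. *)
Lemma inc_supp a : exists2 J, inc J a & 0 < f J.
Proof.
have [k ka] : exists k : 'I_m, k != tag a.
  have [z0|z0] := eqVneq (val (tag a)) 0%N.
    by exists (Ordinal m2); rewrite -val_eqE z0.
  by exists (Ordinal (ltnW m2)); rewrite -val_eqE eq_sym.
pose b : V := Tagged (fun k => 'I_(d k)) (Ordinal (d0 k)).
have /connectP[[|c s] /=] := wi a b.
  by move=> _ ba; rewrite -ba eqxx in ka.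
by move=> /andP[/edge_inc[_ [J [Ja _ fJ]]] _ _]; exists J.
Qed.

Lemma prod_xs_gt0 (P : pred 'I_m) J : (forall k, P k -> k != i) ->
  0 < \prod_(k < m | P k) xs k (J k).
Proof. by move=> Pi; apply: prodr_gt0 => k /Pi ki; exact: (xs0 (a := vtx J k)). Qed.

Lemma grad_inc x a : grad f (tag a) x (tagged a) =
  \sum_(J | inc J a) f J * \prod_(l < m | l != tag a) x l (J l).
Proof. by apply: eq_bigl => J; rewrite /inc val_eqE. Qed.

Lemma phi_gt0 (c : 'I_(d i)) : 0 < phi c.
Proof.
pose a : V := Tagged (fun k => 'I_(d k)) c.
rewrite (grad_inc xs a); have [J Ja fJ] := inc_supp a.
rewrite (bigD1 J)//= ltr_pwDl ?mulr_gt0 ?prod_xs_gt0//.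
by apply: sumr_ge0 => J' _; rewrite mulr_ge0 ?f0// ltW// prod_xs_gt0.
Qed.

(** The [J]-th term of [f] at [xs] with block [i] set to [psi q phi]; as [phi > 0], the latter is a
    plain power. *)
Definition tmass J := f J * phi (J i) `^ (q - 1) * \prod_(k < m | k != i) xs k (J k).

Lemma mu_gt0 J : 0 < f J -> 0 < tmass J.
Proof. by move=> fJ; rewrite !mulr_gt0 ?powR_gt0 ?phi_gt0 ?prod_xs_gt0. Qed.

Lemma mu_ge0 J : 0 <= tmass J.
Proof. by rewrite !mulr_ge0 ?powR_ge0// ltW// prod_xs_gt0. Qed.

Lemma mg_mu_gt0 a : 0 < mg tmass a.
Proof.
have [J Ja fJ] := inc_supp a; rewrite /mg (bigD1 J)//= ltr_pwDl ?mu_gt0//.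
by apply: sumr_ge0 => J' _; exact: mu_ge0.
Qed.

Definition ivtx (c : 'I_(d i)) : V := Tagged (fun k => 'I_(d k)) c.

Lemma mg_mu_i (c : 'I_(d i)) : mg tmass (ivtx c) = phi c `^ (q - 1) * phi c.
Proof.
rewrite (grad_inc xs (ivtx c)) mulr_sumr.
by apply: eq_bigr => J /eqP/= Jc; rewrite /tmass Jc; ring.
Qed.

Section Exponential.
Variables (x : mvec R m) (v : V -> R).
Hypothesis xE : forall a, tag a != i -> at_vtx x a = at_vtx xs a * expR (v a).

Lemma prod_expR (P : pred 'I_m) J : (forall k, P k -> k != i) ->
  \prod_(k < m | P k) x k (J k) =
  (\prod_(k < m | P k) xs k (J k)) * expR (\sum_(k < m | P k) v (vtx J k)).
Proof.
move=> Pi; rewrite expR_sum -big_split/=; apply: eq_bigr => k /Pi ki.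
exact: (xE (a := vtx J k)).
Qed.

(** After multiplication by [phi^(q - 1)] the sum is a [tmass]-weighted sum of exponentials over the
    multi-indices through [c]. *)
Lemma grad_i_expR (c : 'I_(d i)) : grad f i x c = phi c * expR (lam i tmass v (ivtx c)).
Proof.
have pq0 : phi c `^ (q - 1) != 0 by rewrite gt_eqF// powR_gt0// phi_gt0.
apply: (mulfI pq0); rewrite mulrA -mg_mu_i -(sum_cond1 tmass) expR_lse; last first.
- by rewrite sum_cond1 mg_mu_gt0.
- by apply: cond_ge0; exact: mu_ge0.
rewrite sum_cond (grad_inc x (ivtx c)) mulr_sumr; apply: eq_bigr => J /eqP/= Jc.
by rewrite prod_expR// /tmass /offsum Jc; ring.
Qed.

Lemma grad_i_gt0 (c : 'I_(d i)) : 0 < grad f i x c.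
Proof. by rewrite grad_i_expR mulr_gt0 ?expR_gt0 ?phi_gt0. Qed.

Lemma psi_gt0 r (y : nat -> R) j : 0 < y j -> psi r y j = y j `^ (r - 1).
Proof. by move=> y0; rewrite /psi gtr0_norm// gtr0_sg// mulr1. Qed.

(** The factor [at_vtx xs a] restores the coordinate that the gradient omits, so each term is
    [tmass J] times an exponential. *)
Lemma grad_off_expR a : tag a != i ->
  at_vtx xs a * grad f (tag a) (replace x i (psi q (grad f i x))) (tagged a) =
  mg tmass a * expR (lse (cond tmass a) (ell i tmass q v a)).
Proof.
move=> ai; rewrite -sum_cond1 expR_lse; last first.
- by rewrite sum_cond1 mg_mu_gt0.
- by apply: cond_ge0; exact: mu_ge0.
rewrite sum_cond grad_inc mulr_sumr; apply: eq_bigr => J /eqP Ja.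
rewrite (bigD1 i) 1?eq_sym//= {1}/replace eqxx psi_gt0 ?grad_i_gt0// grad_i_expR.
rewrite (eq_bigr (fun k => x k (J k))); last first.
  by move=> k /andP[_ /negbTE ki]; rewrite /replace ki.
rewrite (eq_bigl (fun k => (k != i) && (k != tag a))); last first.
  by move=> k; rewrite andbC.
rewrite prod_expR; last by move=> k /andP[].
rewrite /ell expRD [tmass J in RHS]/tmass [in RHS](bigD1 (tag a))//=.
rewrite /at_vtx -Ja.
rewrite powRM ?expR_ge0 ?ltW ?phi_gt0// -expRM [_ * (q - 1)]mulrC.
by rewrite -/(ivtx (J i)) -/(vtx J i); ring.
Qed.

End Exponential.

Local Notation F := (\sum_(c < d i) phi c `^ q).

Lemma F_gt0 : 0 < F.
Proof.
pose c0 := Ordinal (d0 i); rewrite (bigD1 c0)// ltr_pwDl ?powR_gt0 ?phi_gt0//.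
by apply: sumr_ge0 => c _; exact: powR_ge0.
Qed.

Hypothesis xs_eig : forall a, tag a != i ->
  grad f (tag a) (replace xs i (psi q phi)) (tagged a) =
  F * at_vtx xs a `^ (p (tag a) - 1).

Lemma lse_ell0 a : lse (cond tmass a) (ell i tmass q (fun=> 0) a) = 0.
Proof.
apply/eqP; rewrite -normr_le0; apply: lse_norm.
- by apply: cond_ge0; exact: mu_ge0.
- by rewrite sum_cond1 mg_mu_gt0.
move=> J _; rewrite -[leRHS](mulr0 (q * m%:R)).
apply: (@ell_norm _ _ _ _ _ _ mu_ge0 mg_mu_gt0) => //; first exact: dual_gt1.
by move=> b; rewrite normr0.
Qed.

(** The case [v = 0] of [grad_off_expR], combined with the eigenvector equation. *)
Lemma mg_mu_off a : tag a != i -> mg tmass a = F * at_vtx xs a `^ p (tag a).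
Proof.
move=> ai; have xE b : tag b != i -> at_vtx xs b = at_vtx xs b * expR 0.
  by rewrite expR0 mulr1.
have := @grad_off_expR xs (fun=> 0) xE a ai.
rewrite lse_ell0 expR0 mulr1 xs_eig// => <-.
rewrite mulrCA mulr_powRB1//; first by rewrite ltW// xs0.
by rewrite (lt_trans _ (p1 _)).
Qed.

(** The power [(p - 1)^-1] in [psi] turns [xs^(p - 1)] back into [xs], matches the division by
    [p - 1] in [logmap], and leaves a power of [F] that is constant on each block. *)
Lemma sHG_expR x v a :
  (forall b, tag b != i -> at_vtx x b = at_vtx xs b * expR (v b)) ->
  tag a != i -> sHG f p i (tag a) x (tagged a) =
  F `^ (p (tag a) - 1)^-1 * at_vtx xs a * expR (logmap i tmass q p v a).
Proof.
move=> xE ai; have xa := xs0 ai.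
have pa : p (tag a) - 1 != 0 by rewrite gt_eqF// subr_gt0.
have gE : grad f (tag a) (replace x i (psi q (grad f i x))) (tagged a) =
    F * at_vtx xs a `^ (p (tag a) - 1) * expR (logmap i tmass q p v a * (p (tag a) - 1)).
  apply: (mulfI (lt0r_neq0 xa)); rewrite (grad_off_expR xE)// mg_mu_off//.
  rewrite /logmap (negbTE ai) divfK// !mulrA; congr (_ * _).
  rewrite -mulr_powRB1 ?(ltW xa)//; first by ring.
  by rewrite (lt_trans _ (p1 _)).
rewrite /sHG psi_gt0; last by rewrite gE !mulr_gt0 ?expR_gt0 ?powR_gt0 ?F_gt0.
rewrite gE dualB1// !powRM ?mulr_ge0 ?powR_ge0 ?expR_ge0// ?(ltW F_gt0)//.
by rewrite -powRrM divff// powRr1 ?(ltW xa)// -expRM mulfK.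
Qed.

End LogCoordinates.

(** Young's inequality with slack. With [S] the logarithm of the product, tangents of [expR] at [S]
    bound the powers from below, and [expR S * (1 - S) <= 1] absorbs the missing weight
    [1 - \sum_k (p k)^-1]. *)
Lemma prod_le_young (R : realType) (I : finType) (r p : I -> R) :
  (forall k, 0 <= r k) -> (forall k, 0 < p k) -> \sum_k (p k)^-1 <= 1 ->
  \prod_k r k <= \sum_k (r k `^ p k) / p k + (1 - \sum_k (p k)^-1).
Proof.
move=> r0 p0 p1.
have [/existsP[k /eqP rk]|/existsPn rn] := boolP [exists k, r k == 0].
  rewrite (bigD1 k)//= rk mul0r addr_ge0 ?subr_ge0//.
  by apply: sumr_ge0 => j _; rewrite divr_ge0 ?powR_ge0// ltW.
have rp k : 0 < r k by rewrite lt_def rn r0.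
pose s k := ln (r k); pose S := \sum_k s k.
have -> : \prod_k r k = expR S.
  by rewrite expR_sum; apply: eq_bigr => k _; rewrite lnK ?posrE.
have rE k : r k `^ p k = expR (p k * s k) by rewrite /powR gt_eqF.
have h k : expR S * ((p k)^-1 + s k - S / p k) <= r k `^ p k / p k.
  rewrite rE (_ : _ - _ = (1 + (p k * s k - S)) / p k); last first.
    by field; rewrite gt_eqF.
  rewrite mulrA ler_pM2r ?invr_gt0//.
  rewrite -[X in _ <= expR X](subrK S) expRD [leRHS]mulrC ler_wpM2l ?expR_ge0//.
  exact: expR_ge1Dx.
have h1 : expR S * (1 - S) <= 1.
  have := expR_ge1Dx (- S); rewrite expRN => h1.
  by rewrite mulrC -ler_pdivlMr ?expR_gt0// mul1r.
set P := \sum_k (p k)^-1 in p1 *.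
have h2 : expR S * (P + S - S * P) <= \sum_k r k `^ p k / p k.
  rewrite /P {2}/S mulr_sumr -big_split -sumrB mulr_sumr/=.
  by apply: ler_sum => k _; exact: h.
have h3 : 0 <= 1 - P by rewrite subr_ge0.
have := ler_wpM2r h3 h1; lra.
Qed.

(** * The tensor norm *)

Section TensorNorm.
Variables (R : realType) (m : nat) (d : 'I_m -> nat).
Variables (f : MI d -> R) (p : 'I_m -> R) (i : 'I_m) (xs : mvec R m).
Local Notation V := {k : 'I_m & 'I_(d k)}.
Implicit Types (J : MI d) (a b : V) (x : mvec R m).

Lemma sum_tag k (G : V -> R) :
  \sum_(a | tag a == k) G a = \sum_(j < d k) G (Tagged (fun k => 'I_(d k)) j).
Proof.
transitivity (\sum_(l | l == k) \sum_(j < d l) G (Tagged (fun k => 'I_(d k)) j)).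
  rewrite (@sig_big_dep _ _ _ _ _ (pred1 k) (fun k (j : 'I_(d k)) => true)
    (fun k j => G (Tagged (fun k => 'I_(d k)) j))) /=.
  by apply: eq_big => [[l j]|[l j]] //=; rewrite andbT.
by rewrite big_pred1_eq.
Qed.

Lemma sum_marginal (nu : MI d -> R) k (G : V -> R) :
  \sum_J nu J * G (vtx J k) = \sum_(a | tag a == k) mg nu a * G a.
Proof.
transitivity (\sum_J \sum_(a | (tag a == k) && inc J a) nu J * G a).
  apply: eq_bigr => J _; rewrite (sum_inc (pred1 k) J (fun a => nu J * G a)).
  by rewrite big_pred1_eq.
under eq_bigr do rewrite big_mkcondr.
rewrite exchange_big/=; apply: eq_bigr => a _.
by rewrite -big_mkcond -mulr_suml.
Qed.

Lemma pnorm_powR n r (y : nat -> R) : 0 < r ->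
  pnorm n r y `^ r = \sum_(j < n) `|y j| `^ r.
Proof.
move=> r0; rewrite /pnorm -powRrM mulVf ?gt_eqF// powRr1//.
by apply: sumr_ge0 => j _; exact: powR_ge0.
Qed.

Lemma pnorm_gt0 n r (y : nat -> R) j : 0 < r -> (j < n)%N -> y j != 0 ->
  0 < pnorm n r y.
Proof.
move=> r0 jn yj; apply: powR_gt0; rewrite (bigD1 (Ordinal jn))//= ltr_pwDl//.
  by rewrite powR_gt0// normr_gt0.
by apply: sumr_ge0 => k _; exact: powR_ge0.
Qed.

Lemma pnorm_eq1 n r (y : nat -> R) : 0 < r ->
  \sum_(j < n) `|y j| `^ r = 1 -> pnorm n r y = 1.
Proof. by move=> r0 h; rewrite /pnorm h powR1. Qed.

Hypothesis m2 : (2 <= m)%N.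
Hypothesis d0 : forall k, (0 < d k)%N.
Hypothesis f0 : forall J, 0 <= f J.
Hypothesis wi : weakly_irreducible f.
Hypothesis p1 : forall k, 1 < p k.
Hypothesis pq : forall k, k != i -> (m.-1)%:R * dual (p i) <= p k.
Hypothesis xs0 : forall a, tag a != i -> 0 < at_vtx xs a.
Hypothesis xsN : onS d p i xs.

Local Notation q := (dual (p i)).
Local Notation phi := (grad f i xs).
Local Notation F := (\sum_(c < d i) phi c `^ q).
Local Notation mu := (tmass f p i xs).

Hypothesis xs_eig : forall a, tag a != i ->
  grad f (tag a) (replace xs i (psi q phi)) (tagged a) =
  F * at_vtx xs a `^ (p (tag a) - 1).

Let p0 k : 0 < p k. Proof. exact: lt_trans (p1 k). Qed.
Let q1 : 1 < q. Proof. exact: dual_gt1. Qed.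
Let F0 : 0 < F. Proof. exact: (F_gt0 p m2 d0 f0 wi xs0). Qed.
Let phi0 (c : 'I_(d i)) : 0 < phi c. Proof. exact: (phi_gt0 m2 d0 f0 wi xs0). Qed.

Lemma dualV : q^-1 = 1 - (p i)^-1.
Proof.
rewrite /dual invf_div; have := p0 i; move=> h.
by rewrite mulrBl divff ?gt_eqF// mul1r.
Qed.

(** The [m - 1] terms with [k != i] are each at most [((m - 1) q)^-1], so together at most
    [q^-1 = 1 - (p i)^-1]. *)
Lemma sum_inv_le1 : \sum_k (p k)^-1 <= 1.
Proof.
rewrite (bigD1 i)//=; have q0 : 0 < q by exact: lt_trans q1.
have m0 : 0 < (m.-1)%:R :> R by rewrite ltr0n -ltnS prednK// ltnW.
have : \sum_(k < m | k != i) (p k)^-1 <= q^-1.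
  apply: (@le_trans _ _ (\sum_(k < m | k != i) ((m.-1)%:R * q)^-1)).
    apply: ler_sum => k ki; rewrite lef_pV2 ?posrE; [exact: pq|exact: p0|].
    exact: mulr_gt0.
  rewrite sum_const_off invfM mulVKf ?gt_eqF//.
by rewrite dualV; lra.
Qed.

(* Block [i] is the maximiser of the linear form [phi] on the unit sphere of
   the p_i-norm. *)
Definition xfull : mvec R m :=
  replace xs i (fun c => phi c `^ (q - 1) / F `^ (p i)^-1).

Lemma xfull_i (c : 'I_(d i)) : xfull i c = phi c `^ (q - 1) / F `^ (p i)^-1.
Proof. by rewrite /xfull /replace eqxx. Qed.

Lemma xfull_off k : k != i -> xfull k = xs k.
Proof. by rewrite /xfull /replace => /negbTE ->. Qed.

Lemma xfull_gt0 k (j : 'I_(d k)) : 0 < xfull k j.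
Proof.
have [ki|ki] := eqVneq k i.
  by move: j; rewrite ki => j; rewrite xfull_i divr_gt0// powR_gt0.
rewrite xfull_off//; exact: (xs0 (a := Tagged (fun k => 'I_(d k)) j)).
Qed.

(** With block [i] completed, the marginals of [tmass] have the same form in all blocks; in block
    [i] this rests on [(q - 1) * p i = q]. *)
Lemma mg_xfull a : mg mu a = F * at_vtx xfull a `^ p (tag a).
Proof.
have [ai|ai] := eqVneq (tag a) i; last first.
  rewrite (mg_mu_off m2 d0 f0 wi p1 xs0 xs_eig ai).
  by rewrite /at_vtx xfull_off.
case: a ai => k c /= ki; move: c; rewrite {}ki => c.
rewrite (mg_mu_i f p xs c) /at_vtx/= xfull_i powRM ?powR_ge0 ?invr_ge0 ?powR_ge0//.
rewrite -powR_inv1 ?powR_ge0// -!powRrM.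
have -> : (p i)^-1 * (-1 * p i) = -1 by field; rewrite gt_eqF.
rewrite powR_inv1 ?ltW// mulrCA divff ?gt_eqF// mulr1 mulrC mulr_powRB1 ?ltW//.
  congr (_ `^ _); rewrite /dual; field.
  by rewrite gt_eqF// subr_gt0.
exact: lt_trans q1.
Qed.

Lemma xfull_norm k : pnorm (d k) (p k) (xfull k) = 1.
Proof.
have [->|ki] := eqVneq k i; last by rewrite xfull_off// xsN.
apply: pnorm_eq1 => //.
have /mulfI : F != 0 by rewrite gt_eqF.
apply; rewrite mulr_sumr mulr1; apply: eq_bigr => c _.
rewrite gtr0_norm ?xfull_gt0//.
rewrite -[LHS](mg_xfull (Tagged (fun k => 'I_(d k)) c)) (mg_mu_i f p xs c).
by rewrite mulrC mulr_powRB1 ?ltW//; exact: lt_trans q1.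
Qed.

Lemma sum_mu : \sum_J mu J = F.
Proof.
have := sum_marginal mu i (fun=> 1).
under eq_bigr do rewrite mulr1.
move=> ->; rewrite sum_tag; apply: eq_bigr => c _; rewrite mulr1.
by rewrite (mg_mu_i f p xs c) mulrC mulr_powRB1 ?ltW//; exact: lt_trans q1.
Qed.

Lemma prod_xfull J : f J * \prod_(k < m) xfull k (J k) = mu J / F `^ (p i)^-1.
Proof.
rewrite (bigD1 i)//= xfull_i /tmass (eq_bigr (fun k => xs k (J k))); first by ring.
by move=> k ki; rewrite xfull_off.
Qed.

Lemma F_dual : F / F `^ (p i)^-1 = F `^ q^-1.
Proof.
rewrite dualV powRB ?powRr1 ?(ltW F0)//; last by rewrite (gt_eqF F0) implybT.
Qed.

(** Young's inequality is applied to the ratios [r] of the normalised [x] to [xfull]. The marginals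
    turn each sum of [mu] against the [p k]-th power of [r] into [F], and the weights [(p k)^-1]
    together with the slack add up to 1. *)
Lemma teval_le x : (forall k, 0 < pnorm (d k) (p k) (x k)) ->
  `|teval f x| <= F `^ q^-1 * \prod_k pnorm (d k) (p k) (x k).
Proof.
move=> n0; pose n k := pnorm (d k) (p k) (x k).
pose r a := `|at_vtx x a| / (n (tag a) * at_vtx xfull a).
have xf0 a : 0 < at_vtx xfull a by exact: xfull_gt0.
have r0 a : 0 <= r a by rewrite divr_ge0// mulr_ge0 ?ltW// n0.
have -> : F `^ q^-1 * \prod_k n k = \prod_k n k / F `^ (p i)^-1 * F.
  by rewrite -F_dual; ring.
apply: le_trans (ler_norm_sum _ _ _) _.
have E J : `|f J * \prod_(k < m) x k (J k)| =
    \prod_k n k / F `^ (p i)^-1 * (mu J * \prod_k r (vtx J k)).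
  have -> : \prod_k n k / F `^ (p i)^-1 * (mu J * \prod_k r (vtx J k)) =
     \prod_k n k * (mu J / F `^ (p i)^-1 * \prod_k r (vtx J k)) by ring.
  rewrite -prod_xfull normrM ger0_norm// normr_prod mulrCA -mulrA; congr (_ * _).
  rewrite -!big_split/=; apply: eq_bigr => k _; rewrite /r /=.
  by rewrite /at_vtx/= -/(n k); field; rewrite !gt_eqF// ?n0// xfull_gt0.
rewrite (eq_bigr _ (fun J _ => E J)).
rewrite -mulr_sumr ler_wpM2l//.
  by rewrite divr_ge0 ?powR_ge0// prodr_ge0// => k _; exact/ltW/n0.
apply: (@le_trans _ _ (\sum_J mu J *
    (\sum_k (r (vtx J k) `^ p k) / p k + (1 - \sum_k (p k)^-1)))).
  apply: ler_sum => J _; rewrite ler_wpM2l ?(mu_ge0 p f0 xs0)//.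
  by apply: prod_le_young => //; exact: sum_inv_le1.
under eq_bigr do rewrite mulrDr.
rewrite big_split/= -[X in _ + X]mulr_suml sum_mu.
under eq_bigr do rewrite mulr_sumr.
rewrite exchange_big/= (eq_bigr (fun k => F / p k)).
  by rewrite -mulr_sumr; lra.
move=> k _; under eq_bigr do rewrite mulrA.
rewrite -mulr_suml; congr (_ / _).
rewrite (sum_marginal mu k (fun a => r a `^ p k)).
rewrite (eq_bigr (fun a => F / n k `^ p k * `|at_vtx x a| `^ p k)).
  rewrite -mulr_sumr sum_tag [X in _ * X](_ : _ = n k `^ p k).
    by rewrite divfK// gt_eqF// powR_gt0//; exact: n0.
  by rewrite pnorm_powR.
move=> a /eqP ak; rewrite mg_xfull ak /r ak.
have xa := xf0 a; have nk := n0 k.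
rewrite powRM ?invr_ge0 ?mulr_ge0// ?(ltW xa)// ?(ltW nk)//.
rewrite -powR_inv1 ?mulr_ge0// ?(ltW xa)// ?(ltW nk)// -powRrM mulN1r powRN.
rewrite powRM ?(ltW xa)// ?(ltW nk)//; field.
by rewrite !gt_eqF// powR_gt0.
Qed.

(** [xfull] attains the bound of [teval_le]. *)
Lemma fnorm_eq : fnorm f p = F `^ q^-1.
Proof.
rewrite /fnorm; set E := (X in sup X).
have ub : ubound E (F `^ q^-1).
  move=> _ [x [xn0 ->]].
  have n0 k : 0 < pnorm (d k) (p k) (x k).
    by have [j jd xj] := xn0 k; exact: (pnorm_gt0 _ jd).
  by rewrite ler_pdivrMr ?teval_le// prodr_gt0.
have EF : E (F `^ q^-1).
  exists xfull; split.
    move=> k; exists 0%N => //; have := xfull_gt0 (Ordinal (d0 k)).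
    by move/gt_eqF => /= ->.
  rewrite [X in _ / X]big1; last by move=> k _; exact: xfull_norm.
  rewrite /teval; rewrite (eq_bigr _ (fun J _ => prod_xfull J)).
  by rewrite -mulr_suml sum_mu F_dual divr1 ger0_norm// powR_ge0.
apply: le_anti; rewrite ge_sup//=; last by exists (F `^ q^-1).
by apply: ub_le_sup => //; exists (F `^ q^-1).
Qed.

End TensorNorm.

(** * Critical points of Q_i *)

Section DerivePnorm.
Variable R : realType.

Lemma is_derive_powR_affine (y z r : R) : 0 < y ->
  is_derive (0 : R) (1 : R) (fun t : R => (y + t * z) `^ r) (r * y `^ (r - 1) * z).
Proof.
move=> y0.
have daff : is_derive (0 : R) (1 : R) (fun t : R => y + t * z) z.
  have -> : (fun t : R => y + t * z) = cst y + (z \*: id).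
    by apply/funext => t; rewrite /= fctE/= mulrC.
  by apply: is_derive_eq; rewrite add0r /GRing.scale/= mulr1.
have dpow : is_derive (y + 0 * z) (1 : R) (fun x : R => x `^ r) (r * y `^ (r - 1)).
  by rewrite mul0r addr0; exact: is_derive1_powR.
have := @is_derive1_comp _ (fun x : R => x `^ r) (fun t : R => y + t * z) 0 _ _ dpow daff.
by move=> /is_derive_eq; apply.
Qed.

Lemma is_derive_pnorm n (r : R) (y z : nat -> R) : (0 < n)%N -> 0 < r ->
  (forall j : 'I_n, 0 < y j) ->
  is_derive (0 : R) (1 : R) (fun t : R => pnorm n r (fun j => y j + t * z j))
    ((\sum_(j < n) y j `^ r) `^ (r^-1 - 1) * \sum_(j < n) y j `^ (r - 1) * z j).
Proof.
move=> n0 r0 y0.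
pose A t := \sum_(j < n) (y j + t * z j) `^ r.
have A0 : A 0 = \sum_(j < n) y j `^ r.
  by apply: eq_bigr => j _; rewrite mul0r addr0.
have A0p : 0 < A 0.
  rewrite A0; pose j0 := Ordinal n0; rewrite (bigD1 j0)// ltr_pwDl ?powR_gt0//.
  by apply: sumr_ge0 => j _; exact: powR_ge0.
have dA : is_derive (0 : R) (1 : R) A (\sum_(j < n) r * y j `^ (r - 1) * z j).
  have -> : A = \sum_(j < n) (fun t => (y j + t * z j) `^ r).
    by apply/funext => t; rewrite fct_sumE.
  by apply: is_derive_sum => j; exact: is_derive_powR_affine.
have dP := is_derive1_powR r^-1 A0p.
have := @is_derive1_comp _ (fun x : R => x `^ r^-1) A 0 _ _ dP dA.
move=> /is_derive_eq D.
apply: (@near_eq_is_derive _ _ _ ((fun x : R => x `^ r^-1) \o A)); last first.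
  apply: D; rewrite A0 [r^-1 * _]mulrC -mulrA; congr (_ * _).
  rewrite mulr_sumr; apply: eq_bigr => j _; field.
  by rewrite gt_eqF.
have : \forall t \near (0 : R), forall j : 'I_n, 0 < y j + t * z j.
  suff : forall j : 'I_n, \forall t \near (0 : R), 0 < y j + t * z j.
    move=> h; exact: (@filter_forall R 'I_n (fun j t => 0 < y j + t * z j)
      (nbhs (0 : R)) _ h).
  move=> j.
  have cj : (fun t => y j + t * z j) @ (0 : R) --> y j + 0 * z j.
    by apply: cvgD; [exact: cvg_cst | apply: cvgM; [exact: cvg_id | exact: cvg_cst]].
  apply: (cvgr_gt _ cj); by rewrite mul0r addr0.
apply: filterS => t ht; rewrite /pnorm/=; congr (_ `^ _).
by apply: eq_bigr => j _; rewrite gtr0_norm.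
Qed.

End DerivePnorm.

Section CriticalPoint.
Variables (R : realType) (m : nat) (d : 'I_m -> nat).
Variables (f : MI d -> R) (p : 'I_m -> R) (i : 'I_m) (xs : mvec R m).
Local Notation V := {k : 'I_m & 'I_(d k)}.
Implicit Types (J : MI d) (a b : V) (x : mvec R m).
Hypothesis m2 : (2 <= m)%N.
Hypothesis d0 : forall k, (0 < d k)%N.
Hypothesis f0 : forall J, 0 <= f J.
Hypothesis wi : weakly_irreducible f.
Hypothesis p1 : forall k, 1 < p k.
Hypothesis xs0 : forall a, tag a != i -> 0 < at_vtx xs a.
Hypothesis xsN : onS d p i xs.
Hypothesis crit : critical f p i xs.

Local Notation q := (dual (p i)).
Local Notation phi := (grad f i xs).
Local Notation F := (\sum_(c < d i) phi c `^ q).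

(** The mixed second derivative of [f] in the coordinates [(i, c)] and [a]. *)
Definition partial a (c : nat) : R :=
  \sum_(J : MI d | (val (J i) == c) && inc J a)
    f J * \prod_(k < m | (k != i) && (k != tag a)) xs k (J k).

Lemma grad_bump a t c : tag a != i ->
  grad f i (Defs.bump xs (tag a) (tagged a) t) c = phi c + t * partial a c.
Proof.
move=> ai; rewrite /grad /partial mulr_sumr big_mkcondr -big_split/=.
apply: eq_bigr => J _; rewrite (bigD1 (tag a))//= [in RHS](bigD1 (tag a))//=.
have -> : \prod_(k < m | (k != i) && (k != tag a))
      Defs.bump xs (tag a) (tagged a) t k (J k)
    = \prod_(k < m | (k != i) && (k != tag a)) xs k (J k).
  by apply: eq_bigr => k /andP[_ /negbTE ka]; rewrite /Defs.bump ka addr0.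
rewrite /Defs.bump eqxx/= /inc val_eqE; case: ifP => _; ring.
Qed.

Lemma sum_partial a : tag a != i ->
  \sum_(c < d i) phi c `^ (q - 1) * partial a c =
  grad f (tag a) (replace xs i (psi q phi)) (tagged a).
Proof.
move=> ai; rewrite grad_inc [RHS](partition_big (fun J => J i) xpredT)//=.
apply: eq_bigr => c _; rewrite /partial mulr_sumr.
apply: eq_big => [J|J /andP[/eqP Jc _]]; first by rewrite andbC val_eqE.
rewrite [in RHS](bigD1 i) 1?eq_sym//= {1}/replace eqxx Jc psi_gt0; last first.
  exact: (phi_gt0 m2 d0 f0 wi xs0).
rewrite mulrCA; congr (_ * (_ * _)); apply: eq_big => [k|k /andP[/negbTE ki _]].
  by rewrite andbC.
by rewrite /replace ki.
Qed.

(** Along one coordinate the quotient is [N / D] with [D 0 = 1], so criticality says [N' = N D'] at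
    0; the common factor [F^(1/q - 1)] cancels. *)
Lemma critical_eigen a : tag a != i ->
  grad f (tag a) (replace xs i (psi q phi)) (tagged a) =
  F * at_vtx xs a `^ (p (tag a) - 1).
Proof.
move=> ai; set l := tag a; set j := tagged a.
have F0 : 0 < F by exact: (F_gt0 p m2 d0 f0 wi xs0).
have q0 : 0 < q by apply: lt_trans (dual_gt1 (p1 i)).
have pl : 0 < p l by apply: lt_trans (p1 l).
pose N t := pnorm (d i) q (fun c => phi c + t * partial a c).
pose D t := pnorm (d l) (p l) (fun k => xs l k + t * (k == j)%:R).
have xl (k : 'I_(d l)) : 0 < xs l k by exact: (xs0 (a := Tagged (fun k => 'I_(d k)) k)).
have dN : is_derive (0 : R) (1 : R) N
    (F `^ (q^-1 - 1) * grad f l (replace xs i (psi q phi)) j).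
  rewrite -sum_partial//; apply: is_derive_pnorm => // c.
  exact: (phi_gt0 m2 d0 f0 wi xs0).
have xsl : \sum_(k < d l) xs l k `^ p l = 1.
  have := pnorm_powR (d l) (xs l) pl; rewrite xsN// powR1 => ->.
  by apply: eq_bigr => k _; rewrite gtr0_norm.
have dD : is_derive (0 : R) (1 : R) D (at_vtx xs a `^ (p l - 1)).
  have := @is_derive_pnorm _ (d l) (p l) (xs l) (fun k => (k == j)%:R) (d0 l) pl xl.
  move=> /is_derive_eq; apply; rewrite xsl powR1 mul1r (bigD1 j)//= eqxx mulr1.
  by rewrite big1 ?addr0// => k /negbTE; rewrite -val_eqE => /= ->; rewrite mulr0.
have D0 : D 0 = 1.
  rewrite -[RHS](xsN ai); congr pnorm; apply/funext => k.
  by rewrite mul0r addr0.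
have NE t : pnorm (d i) q (grad f i (Defs.bump xs l j t)) = N t.
  by congr pnorm; apply/funext => c; rewrite grad_bump.
have DE t : \prod_(k < m | k != i) pnorm (d k) (p k) (Defs.bump xs l j t k) = D t.
  rewrite (bigD1 l)//= big1 ?mulr1.
    congr pnorm; apply/funext => k; rewrite /Defs.bump eqxx/=.
    by case: eqP => _; rewrite ?mulr1 ?mulr0.
  move=> k /andP[ki /negbTE kl]; rewrite -[RHS](xsN ki); congr pnorm.
  by apply/funext => k'; rewrite /Defs.bump kl addr0.
have QE t : Qf f p i (Defs.bump xs l j t) = N t / D t by rewrite /Qf NE DE.
have dQ := crit ai (ltn_ord j).
have DN : \forall t \near (0 : R), D t != 0.
  have : {for 0, continuous D}.
    by apply: differentiable_continuous; apply/derivable1_diffP; case: dD.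
  move=> cD; near=> t; rewrite gt_eqF//; near: t.
  by apply: (cvgr_gt (D 0) cD); rewrite D0.
(* A second computation of the derivative of [N], from [N = Qf * D] near 0; uniqueness of
   derivatives equates the two. *)
have dN' : is_derive (0 : R) (1 : R) N (N 0 * at_vtx xs a `^ (p l - 1)).
  apply: (@near_eq_is_derive _ _ _ ((fun t => Qf f p i (Defs.bump xs l j t)) * D)).
    by apply: filterS DN => t Dt; rewrite fctE QE divfK.
  apply: is_derive_eq.
  by rewrite QE D0 divr1 /GRing.scale/= mulr0 addr0.
have : N 0 * at_vtx xs a `^ (p l - 1) =
   F `^ (q^-1 - 1) * grad f l (replace xs i (psi q phi)) j.
  by have [_ e1] := dN; have [_ e2] := dN'; exact: etrans (esym e2) e1.
have -> : N 0 = F `^ (q^-1 - 1) * F.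
  rewrite /N /pnorm (eq_bigr (fun c : 'I_(d i) => phi c `^ q)); last first.
    move=> c _; rewrite mul0r addr0 gtr0_norm//.
    exact: (phi_gt0 m2 d0 f0 wi xs0).
  by rewrite mulrC mulr_powRB1 ?ltW// invr_gt0.
rewrite -mulrA => /mulfI => /(_ (lt0r_neq0 (powR_gt0 _ F0))) <-//.
Unshelve. all: by end_near. Qed.

End CriticalPoint.

(** * Convergence of HGPM *)

Section CvgHelpers.
Variable R : realType.
Implicit Types u s : nat -> R.

Lemma cvg0_le_norm u s : (forall n, `|u n| <= s n) -> s @ \oo --> (0 : R) ->
  u @ \oo --> (0 : R).
Proof.
move=> us scv; apply: (@squeeze_cvgr _ _ _ _ (fun n => - s n) s) => //.
  by near=> n; rewrite -ler_norml.
by rewrite -[X in _ --> X]oppr0; exact: cvgN.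
Unshelve. all: by end_near. Qed.

Lemma cvg_expR u : u @ \oo --> (0 : R) -> (fun n => expR (u n)) @ \oo --> (1 : R).
Proof.
move=> ucv; rewrite -[X in _ --> X]expR0.
by apply: continuous_cvg => //; exact: continuous_expR.
Qed.

Lemma cvg_powR u (c e : R) : 0 < c -> u @ \oo --> c ->
  (fun n => u n `^ e) @ \oo --> c `^ e.
Proof.
move=> c0 ucv; have cont : {for c, continuous (fun x : R => x `^ e)}.
  apply: differentiable_continuous; apply/derivable1_diffP.
  by case: (is_derive1_powR e c0).
exact: (continuous_cvg _ cont ucv).
Qed.

Lemma inf_range_bounds n (r : 'I_n -> R) (lo hi : R) : (0 < n)%N ->
  (forall j, lo <= r j <= hi) -> lo <= inf (range r) <= hi.
Proof.
move=> n0 h; pose j0 := Ordinal n0; apply/andP; split.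
  by apply: lb_le_inf; [exists (r j0), j0 | move=> _ [j _ <-]; case/andP: (h j)].
apply: (@le_trans _ _ (r j0)); last by case/andP: (h j0).
apply: ge_inf; last by exists j0.
by exists lo => _ [j _ <-]; case/andP: (h j).
Qed.

Lemma sup_range_bounds n (r : 'I_n -> R) (lo hi : R) : (0 < n)%N ->
  (forall j, lo <= r j <= hi) -> lo <= sup (range r) <= hi.
Proof.
move=> n0 h; pose j0 := Ordinal n0; apply/andP; split; last first.
  by apply: ge_sup; [exists (r j0), j0 | move=> _ [j _ <-]; case/andP: (h j)].
apply: (@le_trans _ _ (r j0)); first by case/andP: (h j0).
apply: ub_le_sup; last by exists j0.
by exists hi => _ [j _ <-]; case/andP: (h j).
Qed.

End CvgHelpers.

Section Convergence.
Variables (R : realType) (m : nat) (d : 'I_m -> nat).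
Variables (f : MI d -> R) (p : 'I_m -> R) (i : 'I_m) (xs : mvec R m).
Variables (x : nat -> mvec R m) (lm lp : nat -> R).
Local Notation V := {k : 'I_m & 'I_(d k)}.
Implicit Types (J : MI d) (a b : V).
Hypothesis m2 : (2 <= m)%N.
Hypothesis d0 : forall k, (0 < d k)%N.
Hypothesis f0 : forall J, 0 <= f J.
Hypothesis wi : weakly_irreducible f.
Hypothesis p1 : forall k, 1 < p k.
Hypothesis pq : forall k, k != i -> (m.-1)%:R * dual (p i) <= p k.
Hypothesis xsS : onSpp d p i xs.
Hypothesis crit : critical f p i xs.
Hypothesis x0S : onSpp d p i (x 0%N).
Hypothesis xHG : HGPM_seq f p i x lm lp.

Local Notation q := (dual (p i)).
Local Notation phi := (grad f i xs).
Local Notation F := (\sum_(c < d i) phi c `^ q).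
Local Notation mu := (tmass f p i xs).
Local Notation tau := (logmap i mu q p).
Local Notation W := (Wt i mu p).
Local Notation K := (Kt i mu q).

Let xs0 a : tag a != i -> 0 < at_vtx xs a.
Proof. by move=> ai; case: xsS => _; apply. Qed.
Let xsN : onS d p i xs. Proof. by case: xsS. Qed.
Let p0 k : 0 < p k. Proof. exact: lt_trans (p1 k). Qed.
Let pB k : 0 < p k - 1. Proof. by rewrite subr_gt0. Qed.
Let q1 : 1 < q. Proof. exact: dual_gt1. Qed.
Let q0 : 0 < q. Proof. exact: lt_trans q1. Qed.
Let F0 : 0 < F. Proof. exact: (F_gt0 p m2 d0 f0 wi xs0). Qed.
Let phi0 (c : 'I_(d i)) : 0 < phi c. Proof. exact: (phi_gt0 m2 d0 f0 wi xs0). Qed.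
Let xs_eig := critical_eigen m2 d0 f0 wi p1 xs0 xsN crit.
Let mu0 := mu_ge0 p f0 xs0.
Let mgp := mg_mu_gt0 p m2 d0 f0 wi xs0.

(** The value 0 on block [i] agrees with [logmap] and with the weight 0 there. *)
Definition logc n a : R :=
  if tag a == i then 0 else ln (at_vtx (x n) a / at_vtx xs a).

Let eig_scale k : 0 < F `^ (p k - 1)^-1. Proof. exact: powR_gt0. Qed.

Lemma logcE n a : onSpp d p i (x n) -> tag a != i ->
  at_vtx (x n) a = at_vtx xs a * expR (logc n a).
Proof.
move=> [_ xn0] ai; rewrite /logc (negbTE ai) lnK; last first.
  by rewrite posrE divr_gt0 ?xs0//; exact: xn0.
by rewrite mulrC divfK// gt_eqF// xs0.
Qed.

Lemma HGPM_next n a : tag a != i -> at_vtx (x n.+1) a =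
  sHG f p i (tag a) (x n) (tagged a)
    / pnorm (d (tag a)) (p (tag a)) (sHG f p i (tag a) (x n)).
Proof. by move=> ai; case: (xHG n) => h _ _; exact: h. Qed.

Lemma sHG_logc n a : onSpp d p i (x n) -> tag a != i ->
  sHG f p i (tag a) (x n) (tagged a) =
  F `^ (p (tag a) - 1)^-1 * at_vtx xs a * expR (tau (logc n) a).
Proof.
move=> xn ai; apply: (sHG_expR m2 d0 f0 wi p1 xs0 xs_eig) => // b bi.
exact: logcE.
Qed.

Lemma sHG_gt0 n a : onSpp d p i (x n) -> tag a != i ->
  0 < sHG f p i (tag a) (x n) (tagged a).
Proof. by move=> xn ai; rewrite sHG_logc// !mulr_gt0 ?expR_gt0 ?xs0. Qed.

Lemma pnorm_sHG_gt0 n k : onSpp d p i (x n) -> k != i ->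
  0 < pnorm (d k) (p k) (sHG f p i k (x n)).
Proof.
move=> xn ki; apply: (pnorm_gt0 (p0 k) (d0 k)).
rewrite gt_eqF//.
exact: (@sHG_gt0 n (Tagged (fun k => 'I_(d k)) (Ordinal (d0 k)))).
Qed.

Lemma onSpp_HGPM n : onSpp d p i (x n).
Proof.
elim: n => [|n IH]; first exact: x0S.
have xp k j : k != i -> (j < d k)%N -> 0 < x n.+1 k j.
  move=> ki jd; pose a : V := Tagged (fun k => 'I_(d k)) (Ordinal jd).
  have := @HGPM_next n a ki; rewrite /at_vtx/= => ->.
  by rewrite divr_gt0 ?pnorm_sHG_gt0//; exact: (@sHG_gt0 n a).
split=> [k ki|k ki j jd]; last exact: xp.
have s0 := pnorm_sHG_gt0 IH ki.
apply: pnorm_eq1 => //.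
rewrite (eq_bigr (fun j : 'I_(d k) => `|sHG f p i k (x n) j| `^ p k
   / pnorm (d k) (p k) (sHG f p i k (x n)) `^ p k)).
  by rewrite -mulr_suml -pnorm_powR// divff// gt_eqF// powR_gt0.
move=> j _; have := @HGPM_next n (Tagged (fun k => 'I_(d k)) j) ki.
rewrite /at_vtx/= => ->; rewrite normrM powRM ?normr_ge0//; congr (_ * _).
rewrite ger0_norm ?invr_ge0 ?(ltW s0)// -powR_inv1 ?(ltW s0)// -powRrM mulN1r.
by rewrite powRN.
Qed.

(** Both the power of [F] and the normalising norm depend on the block only. *)
Lemma logc_step n : bconst (fun a : V => tag a)
  (fun a => logc n.+1 a - tau (logc n) a).
Proof.
have xn := onSpp_HGPM n.
have E a : tag a != i -> logc n.+1 a - tau (logc n) a =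
    ln (F `^ (p (tag a) - 1)^-1 /
        pnorm (d (tag a)) (p (tag a)) (sHG f p i (tag a) (x n))).
  move=> ai; rewrite {1}/logc (negbTE ai) HGPM_next// sHG_logc//.
  set P := pnorm _ _ _; have P0 : 0 < P by exact: pnorm_sHG_gt0.
  have -> : F `^ (p (tag a) - 1)^-1 * at_vtx xs a * expR (tau (logc n) a) / P
      / at_vtx xs a = F `^ (p (tag a) - 1)^-1 / P * expR (tau (logc n) a).
    by have xa := xs0 ai; field; rewrite !gt_eqF.
  by rewrite lnM ?posrE ?expR_gt0 ?divr_gt0// expRK addrK.
move=> a b; have [ai|ai] := eqVneq (tag a) i.
  by move=> ab; rewrite /logc /logmap -ab ai eqxx.
by move=> ab; rewrite !E -?ab.
Qed.

Lemma Wt_neq0 a : (W a != 0) = (tag a != i).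
Proof.
rewrite /Wt; case: ifP => ai; first by rewrite eqxx.
by rewrite gt_eqF// mulr_gt0.
Qed.

Lemma logc_supp n a : W a = 0 -> logc n a = 0.
Proof.
by move/eqP; rewrite -[_ == _]negbK Wt_neq0 negbK /logc => ->.
Qed.

(** Off block [i] the summand is [(p k - 1) * F] times the difference of the [p k]-th powers of
    [x n] and [xs], and both powers sum to 1 over the block. *)
Lemma logc_norm n k :
  \sum_(a | tag a == k) W a * (expR (p k * logc n a) - 1) = 0.
Proof.
have [ki|ki] := eqVneq k i.
  by rewrite big1// => a /eqP ak; rewrite /Wt ak ki eqxx mul0r.
have [xnN xn0] := onSpp_HGPM n.
rewrite (eq_bigr (fun a => (p k - 1) * F *
   (`|at_vtx (x n) a| `^ p k - `|at_vtx xs a| `^ p k))); last first.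
  move=> a /eqP ak; have ai : tag a != i by rewrite ak.
  rewrite /Wt (negbTE ai) (mg_mu_off m2 d0 f0 wi p1 xs0 xs_eig ai) ak.
  have xa := xs0 ai.
  have xna : 0 < at_vtx (x n) a by exact: xn0.
  rewrite !gtr0_norm// (logcE (onSpp_HGPM n) ai).
  rewrite powRM ?expR_ge0 ?(ltW xa)// -expRM [logc n a * _]mulrC; ring.
rewrite -mulr_sumr sum_tag sumrB.
have := pnorm_powR (d k) (x n k) (p0 k); have := pnorm_powR (d k) (xs k) (p0 k).
by rewrite xnN// xsN// powR1 => <- <-; rewrite subrr mulr0.
Qed.

Let K0 := Kt_ge0 i mu0 mgp q1.
Let KC := KtC i mu q.
Let KW := Kt_sum mgp pq.

Lemma Kt_conn a b : W a != 0 -> W b != 0 -> connect (fun a b => 0 < K a b) a b.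
Proof.
rewrite !Wt_neq0; apply: (Kt_connect mu0 mgp q1 _ wi) => e e'.
move=> /edge_inc[ee' [J [h1 h2 fJ]]].
split=> //; exists J; split=> //; exact: (mu_gt0 p m2 d0 f0 wi xs0).
Qed.

(** A hyperedge through [a] leads back to [a] by way of its vertex in block [i]. *)
Lemma Kt_diag a : W a != 0 -> 0 < K a a.
Proof.
rewrite Wt_neq0 => ai; have [J Ja fJ] := inc_supp m2 d0 wi a.
apply: (Kt_gt0 mu0 mgp q1 ai ai Ja Ja) => //; exact: (mu_gt0 p m2 d0 f0 wi xs0).
Qed.

Lemma logc_cvg0 : (fun n => wnorm W (logc n)) @ \oo --> (0 : R).
Proof.
apply: (wnorm_cvg0 K0 KC KW Kt_diag Kt_conn (kop_Kt_bconst i q p mgp)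
  (logmap_bconst i q p mu0 mgp) (logmap_ge i mu0 mgp q1 p1)
  (logmap_le0 i mu0 mgp q1 p1) p0
  logc_step logc_norm).
Qed.

Lemma logc_rate : exists nu, 0 < nu < 1 /\ exists N, forall n, (N <= n)%N ->
  wnorm W (fun a => expR (logc n.+1 a) - 1) <=
  nu * wnorm W (fun a => expR (logc n a) - 1).
Proof.
apply: (linear_rate K0 KC KW Kt_diag Kt_conn (kop_Kt_bconst i q p mgp)
  (logmap_bconst i q p mu0 mgp) (logmap_ge i mu0 mgp q1 p1)
  (logmap_le0 i mu0 mgp q1 p1) p0
  logc_supp logc_step logc_norm (logmap_quad i mu0 mgp q1 p1 m2)).
Qed.

Definition logbound n := Num.sqrt (\sum_a (W a)^-1) * wnorm W (logc n).

Let W0 := W_ge0 K0 KW.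

Lemma logbound_ge0 n : 0 <= logbound n.
Proof. by rewrite mulr_ge0 ?sqrtr_ge0 ?wnorm_ge0. Qed.

Lemma logc_le n a : `|logc n a| <= logbound n.
Proof.
have [Wa|Wa] := eqVneq (W a) 0; last exact: coord_le_wnorm.
by rewrite logc_supp// normr0 logbound_ge0.
Qed.

Lemma logbound_cvg c : (fun n => c * logbound n) @ \oo --> (0 : R).
Proof.
rewrite -[X in _ --> X](mulr0 c); apply: cvgM; first exact: cvg_cst.
rewrite /logbound; set S := Num.sqrt _; rewrite -[X in _ --> X](mulr0 S).
apply: cvgM; [exact: cvg_cst | exact: logc_cvg0].
Qed.

Lemma iterates_cvg a : tag a != i -> (fun n => at_vtx (x n) a) @ \oo --> at_vtx xs a.
Proof.
move=> ai.
have -> : (fun n => at_vtx (x n) a) = (fun n => at_vtx xs a * expR (logc n a)).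
  by apply/funext => n; exact: (logcE (onSpp_HGPM n) ai).
rewrite -[X in _ --> X]mulr1; apply: cvgM; first exact: cvg_cst.
apply: cvg_expR; apply: (@cvg0_le_norm _ _ (fun n => 1 * logbound n)).
  by move=> n; rewrite mul1r logc_le.
exact: logbound_cvg.
Qed.

(** The first summand bounds [tau (logc n)] through [logmap_norm], the second bounds [logc n]. *)
Definition ratio_radius k n := (q * m%:R / (p k - 1) + 1) * logbound n.

Lemma ratio_bounds n a : tag a != i ->
  F `^ (p (tag a) - 1)^-1 * expR (- ratio_radius (tag a) n) <=
    sHG f p i (tag a) (x n) (tagged a) / at_vtx (x n) a <=
  F `^ (p (tag a) - 1)^-1 * expR (ratio_radius (tag a) n).
Proof.
move=> ai; set s := ratio_radius _ _; have xn := onSpp_HGPM n.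
rewrite sHG_logc// [at_vtx (x n) a]logcE//.
have -> : F `^ (p (tag a) - 1)^-1 * at_vtx xs a * expR (tau (logc n) a)
    / (at_vtx xs a * expR (logc n a)) =
    F `^ (p (tag a) - 1)^-1 * expR (tau (logc n) a - logc n a).
  rewrite expRB; have xa := xs0 ai; field.
  by rewrite !gt_eqF// expR_gt0.
have : `|tau (logc n) a - logc n a| <= s.
  apply: le_trans (ler_normB _ _) _; rewrite /s
    /ratio_radius mulrDl mul1r lerD ?logc_le//.
  rewrite mulrAC; apply: (logmap_norm i mu0 mgp q1 p1); first exact: logbound_ge0.
  exact: logc_le.
by rewrite ler_norml !(ler_pM2l (eig_scale _)) !ler_expR.
Qed.

(** The exponents in [lm] and [lp] make each of the [m - 1] blocks contribute
    [F^(1 / (q (m - 1)))]. *)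
Lemma eigen_prod : \prod_(l < m | l != i)
    (F `^ (p l - 1)^-1) `^ ((p l - 1) / (q * (m.-1)%:R)) = F `^ q^-1.
Proof.
rewrite (eq_bigr (fun=> F `^ (q * (m.-1)%:R)^-1)); last first.
  move=> l li; rewrite -powRrM; congr (_ `^ _); rewrite mulKf//.
  by rewrite gt_eqF.
rewrite prodr_const cardC1 card_ord -powR_mulrn ?powR_ge0// -powRrM.
congr (_ `^ _); field; rewrite gt_eqF//= pnatr_eq0.
by rewrite -lt0n -ltnS prednK// ltnW.
Qed.

Lemma collatz_cvg (lb : forall l : 'I_m, (nat -> R)) (lam : nat -> R) :
  (forall n, lam n.+1 = \prod_(l < m | l != i)
     lb l n `^ ((p l - 1) / (q * (m.-1)%:R))) ->
  (forall l n, l != i -> F `^ (p l - 1)^-1 * expR (- ratio_radius l n) <= lb l n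
     <= F `^ (p l - 1)^-1 * expR (ratio_radius l n)) ->
  lam @ \oo --> fnorm f p.
Proof.
move=> lamE lbs; rewrite (fnorm_eq m2 d0 f0 wi p1 pq xs0 xsN xs_eig) -eigen_prod.
(* [lam 0] is unconstrained, so the limit is taken along the shifted sequence. *)
rewrite -(cvg_shiftS lam).
have -> : [sequence lam n.+1]_n = (fun n => \prod_(l < m | l != i)
     lb l n `^ ((p l - 1) / (q * (m.-1)%:R))) by apply/funext => n; exact: lamE.
apply: cvg_big => [|l li]; first exact: mul_continuous.
apply: cvg_powR => //.
pose s := ratio_radius l.
have scv : s @ \oo --> (0 : R) by exact: logbound_cvg.
apply: (@squeeze_cvgr _ _ _ _ (fun n => F `^ (p l - 1)^-1 * expR (- s n))
  (fun n => F `^ (p l - 1)^-1 * expR (s n))).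
- by near=> n; exact: lbs.
- rewrite -[X in _ --> X]mulr1; apply: cvgM; first exact: cvg_cst.
  by apply: cvg_expR; rewrite -[X in _ --> X]oppr0; exact: cvgN.
- rewrite -[X in _ --> X]mulr1; apply: cvgM; first exact: cvg_cst.
  exact: cvg_expR.
Unshelve. all: by end_near. Qed.

Lemma lower_cvg : lm @ \oo --> fnorm f p.
Proof.
apply: (@collatz_cvg (fun l n =>
  inf (range (fun j : 'I_(d l) => sHG f p i l (x n) j / x n l j)))).
  by move=> n; case: (xHG n).
move=> l n li; apply: inf_range_bounds => // j.
exact: (@ratio_bounds n (Tagged (fun k => 'I_(d k)) j)).
Qed.

Lemma upper_cvg : lp @ \oo --> fnorm f p.
Proof.
apply: (@collatz_cvg (fun l n =>
  sup (range (fun j : 'I_(d l) => sHG f p i l (x n) j / x n l j)))).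
  by move=> n; case: (xHG n).
move=> l n li; apply: sup_range_bounds => // j.
exact: (@ratio_bounds n (Tagged (fun k => 'I_(d k)) j)).
Qed.

(** On the unit spheres the denominator of [Qf] is 1, and the numerator is the norm of
    [phi * expR lam] with [lam] tending to 0. *)
Lemma Qf_cvg : (fun n => Qf f p i (x n)) @ \oo --> fnorm f p.
Proof.
rewrite (fnorm_eq m2 d0 f0 wi p1 pq xs0 xsN xs_eig).
have -> : (fun n => Qf f p i (x n)) = (fun n => (\sum_(c < d i)
    (phi c * expR (lam i mu (logc n) (ivtx c))) `^ q) `^ q^-1).
  apply/funext => n; have [xnN _] := onSpp_HGPM n.
  rewrite /Qf big1; last by move=> k; exact: xnN.
  rewrite divr1; congr (_ `^ _); apply: eq_bigr => c _.
  have xE b : tag b != i -> at_vtx (x n) b = at_vtx xs b * expR (logc n b).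
    by apply: logcE; exact: onSpp_HGPM.
  rewrite (grad_i_expR p m2 d0 f0 wi xs0 xE) gtr0_norm//.
  by rewrite mulr_gt0 ?expR_gt0.
apply: cvg_powR => //; apply: cvg_big => [|c _]; first exact: add_continuous.
apply: cvg_powR => //; rewrite -[X in _ --> X]mulr1.
apply: cvgM; first exact: cvg_cst.
apply: cvg_expR; apply: (@cvg0_le_norm _ _ (fun n => m%:R * logbound n)).
  move=> n; apply: (lam_norm i mu0 mgp); first exact: logbound_ge0.
  exact: logc_le.
exact: logbound_cvg.
Qed.

(** Division by [xs] turns the error of [x n] into [expR (logc n) - 1], the quantity controlled by
    [logc_rate]. *)
Definition offnorm (y : mvec R m) : R :=
  wnorm W (fun a => at_vtx y a / at_vtx xs a).

Lemma offnorm_norm : is_norm_off d i offnorm.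
Proof.
split.
- move=> y z yz; apply: eq_wnorm => // a; rewrite Wt_neq0 => ai.
  by congr (_ / _); exact: yz.
- move=> y z; apply: le_trans (ler_wnormD W0 _ _); rewrite le_eqVlt.
  apply/orP; left; apply/eqP; congr wnorm; apply/funext => a.
  by rewrite -mulrDl.
- move=> c y; rewrite /offnorm -wnormZ; congr wnorm; apply/funext => a.
  by rewrite mulrA.
- move=> y y0 k ki j jd; pose a : V := Tagged (fun k => 'I_(d k)) (Ordinal jd).
  have Wa : W a != 0 by rewrite Wt_neq0.
  have := coord_le_wnorm W0 (fun a => at_vtx y a / at_vtx xs a) Wa.
  rewrite -/(offnorm y) y0 mulr0 normr_le0 mulf_eq0 invr_eq0.
  by rewrite (gt_eqF (xs0 _))// orbF => /eqP.
Qed.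

Lemma offnorm_logc n : offnorm (mvsub (x n) xs) = wnorm W (fun a => expR (logc n a) - 1).
Proof.
apply: eq_wnorm => // a; rewrite Wt_neq0 => ai.
have -> : at_vtx (mvsub (x n) xs) a = at_vtx (x n) a - at_vtx xs a by [].
rewrite (logcE (onSpp_HGPM n))//; field.
by rewrite gt_eqF// xs0.
Qed.

Lemma offnorm_rate : exists nu : R, 0 < nu < 1 /\
  exists k0 : nat, forall k, (k0 <= k)%N ->
    offnorm (mvsub (x k.+1) xs) <= nu * offnorm (mvsub (x k) xs).
Proof.
have [nu [nu01 [N HN]]] := logc_rate; exists nu; split=> //; exists N => n /HN.
by rewrite !offnorm_logc.
Qed.

End Convergence.

Theorem theorem7 (R : realType) (m : nat) (d : 'I_m -> nat)
    (f : MI d -> R) (p : 'I_m -> R) (i : 'I_m)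
    (xs : mvec R m) (x : nat -> mvec R m) (lm lp : nat -> R) :
  (2 <= m)%N ->
  (forall k, (0 < d k)%N) ->
  (forall J, 0 <= f J) ->
  weakly_irreducible f ->
  (forall k, 1 < p k) ->
  (forall k, k != i -> (m.-1)%:R * dual (p i) <= p k) ->
  (m = 2%N -> forall k, k != i -> p i <= p k) ->
  (* xs is the unique strictly positive critical point of Q_i in S_++ *)
  onSpp d p i xs -> critical f p i xs ->
  (forall y, onSpp d p i y -> critical f p i y -> eq_off d i y xs) ->
  (* HGPM with index i started at x 0 in S_++ *)
  onSpp d p i (x 0%N) ->
  HGPM_seq f p i x lm lp ->
  (forall l, l != i -> forall j, (j < d l)%N ->
      (fun n => x n l j) @ \oo --> xs l j) /\
  lm @ \oo --> fnorm f p /\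
  lp @ \oo --> fnorm f p /\
  (fun n => Qf f p i (x n)) @ \oo --> fnorm f p /\
  exists N : mvec R m -> R, is_norm_off d i N /\
    exists nu : R, 0 < nu < 1 /\
    exists k0 : nat, forall k, (k0 <= k)%N ->
      N (mvsub (x k.+1) xs) <= nu * N (mvsub (x k) xs).
Proof.
move=> m2 d0 f0 wi p1 pq _ xsS crit _ x0S xHG; split.
  move=> l li j jd.
  exact: (iterates_cvg m2 d0 f0 wi p1 pq xsS crit x0S xHG
    (a := Tagged (fun k => 'I_(d k)) (Ordinal jd)) li).
split; first exact: (lower_cvg m2 d0 f0 wi p1 pq xsS crit x0S xHG).
split; first exact: (upper_cvg m2 d0 f0 wi p1 pq xsS crit x0S xHG).
split; first exact: (Qf_cvg m2 d0 f0 wi p1 pq xsS crit x0S xHG).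
exists (offnorm (d := d) f p i xs); split.
  exact: (offnorm_norm m2 d0 f0 wi p1 pq xsS).
exact: (offnorm_rate m2 d0 f0 wi p1 pq xsS crit x0S xHG).
Qed.
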